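(* Let $m\in\mathbb{Z}_{\ge2}\sqcup\{\infty\}$, let $R$ be a range set, let $l\in(0,\infty]$, and let $(X,d)$ be the $R$-Urysohn universal ultrametric space. Then $(\mathscr{K}_{m,l}(X),\mathcal{HD}_d)$ is the $R$-Urysohn universal ultrametric space. In particular, $(\mathscr{K}_{m,l}(X),\mathcal{HD}_d)$ is isometric to $(X,d)$.
   Context: $\mathscr{K}(X)$ is the set of all non-empty compact subsets of $X$, and $\mathscr{K}_{m,l}(X)$ is the set of all $E\in\mathscr{K}(X)$ with $\mathrm{Card}(E)\le m$ and $\mathrm{diam}(E)\le l$, where $\mathrm{Card}(E)\le\infty$ and $\mathrm{diam}(E)\le\infty$ impose no restriction. $\mathcal{HD}_d(E,F)=\max\{\sup_{a\in E}d(a,F),\sup_{b\in F}d(b,E)\}$ is the Hausdorff distance, where $d(x,A)=\inf_{a\in A}d(x,a)$. A range set is a subset $R\subseteq[0,\infty)$ with $0\in R$. An ultrametric space $(X,d)$ (i.e. $d(x,y)\le\max\{d(x,z),d(z,y)\}$) is $R$-valued if $d(x,y)\in R$ for all $x,y\in X$. $\mathscr{N}(R)=\mathscr{N}(R,\omega_0)$ is the class of all finite $R$-valued ultrametric spaces. For a class $\mathscr{C}$ of metric spaces, $(X,d)$ is $\mathscr{C}$-injective if it is non-empty and for all $(Y,e),(Z,h)\in\mathscr{C}$ and all isometric (distance-preserving) embeddings $\phi\colon Y\to Z$, $f\colon Y\to X$ there is an isometric embedding $F\colon Z\to X$ with $F\circ\phi=f$. If $R$ is finite or countable, the $R$-Urysohn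 universal ultrametric space is the separable complete $\mathscr{N}(R)$-injective $R$-valued ultrametric space (known to exist and be unique up to isometry). If $R$ is uncountable, the $R$-Urysohn universal ultrametric space is the $R$-petaloid ultrametric space (known to exist and be unique up to isometry), defined as follows. A subset $E\subseteq[0,\infty)$ is semi-sporadic if $E=\{0\}\cup\{a_i\mid i\ge0\}$ for some strictly decreasing sequence $(a_i)_{i\ge 0}$ in $(0,\infty)$ with $a_i\to0$; it is tenuous if it is finite or semi-sporadic. $\mathbf{TEN}(R)$ is the set of all tenuous range sets contained in $R$. For uncountable $R$, a metric space $(X,d)$ is $R$-petaloid if it is an $R$-valued ultrametric space and there is a family $\{\Pi(X,S)\}_{S\in\mathbf{TEN}(R)}$ of subspaces of $X$ (an $R$-petal of $X$) such that: (P1) if $S\in\mathbf{TEN}(R)$ and $S\ne\{0\}$, then $(\Pi(X,S),d)$ is the $S$-Urysohn universal ultrametric space, i.e. a separable complete $\mathscr{N}(S)$-injective $S$-valued ultrametric space; (P2) $\bigcup_{S\in\mathbf{TEN}(R)}\Pi(X,S)=X$; (P3) $\Pi(X,S)\cap\Pi(X,T)=\Pi(X,S\cap T)$ for all $S,T\in\mathbf{TEN}(R)$; (P4) if $S,T\in\mathbf{TEN}(R)$ and $x\in\Pi(X,T)$, then $d(x,\Pi(X,S))\in\{0\}\cup(T\setminus S)$. *)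

(* Defs.v *)
From HB Require Import structures.
From mathcomp Require Import all_boot all_order all_algebra.
From mathcomp Require Import all_classical all_reals all_analysis.

Set Implicit Arguments.
Unset Strict Implicit.
Unset Printing Implicit Defensive.

Import Order.TTheory GRing.Theory Num.Theory.
Import numFieldNormedType.Exports.

Local Open Scope classical_set_scope.
Local Open Scope ring_scope.

Section HausdorffDistance.
Context {R : realType} {X : metricType R}.
Implicit Types (x y : X) (E F G : set X).

(* Values are extended reals, so that the distance to the empty set is +oo. *)
Definition dist_to_set x E : \bar R := ereal_inf [set (mdist x a)%:E | a in E].

Definition diam E : \bar R :=
  ereal_sup [set (mdist a b)%:E | a in E & b in E].

Definition hausdorff_dist E F : \bar R :=
  Order.max (ereal_sup [set dist_to_set a F | a in E])
            (ereal_sup [set dist_to_set b E | b in F]).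

Lemma dist_to_set_ge0 x E : (0 <= dist_to_set x E)%E.
Proof.
by apply: le_ereal_inf_tmp => _ [a _ <-]; rewrite lee_fin mdist_ge0.
Qed.

Lemma hausdorff_distC E F : hausdorff_dist E F = hausdorff_dist F E.
Proof. by rewrite /hausdorff_dist maxC. Qed.

Lemma hausdorff_dist_ge0 E F : E !=set0 -> (0 <= hausdorff_dist E F)%E.
Proof.
move=> [x Ex]; rewrite /hausdorff_dist le_max; apply/orP; left.
by apply: (le_trans (dist_to_set_ge0 x F)); apply: ereal_sup_ubound; exists x.
Qed.

Lemma dist_to_set_leP x E (r : R) : (dist_to_set x E <= r%:E)%E <->
  forall e : R, 0 < e -> exists2 a, E a & mdist x a < r + e.
Proof.
split=> [xE e e0|H].
  have : (dist_to_set x E < (r + e)%:E)%E.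
    by apply: le_lt_trans xE _; rewrite lte_fin ltrDl.
  by move=> /ereal_inf_lt[_ [a Ea <-]]; rewrite lte_fin => ?; exists a.
apply/lee_addgt0Pr => e e0; have [a Ea xa] := H _ e0.
apply: (@le_trans _ _ (mdist x a)%:E); last by rewrite -EFinD lee_fin ltW.
by apply: ereal_inf_lbound; exists a.
Qed.

Lemma hausdorff_dist_leP E F (r : R) : (hausdorff_dist E F <= r%:E)%E <->
  (forall a, E a -> (dist_to_set a F <= r%:E)%E) /\
  (forall b, F b -> (dist_to_set b E <= r%:E)%E).
Proof.
rewrite /hausdorff_dist ge_max; split=> [/andP[EF FE]|[EF FE]].
  by split=> [a Ea|b Fb]; [apply: le_trans EF|apply: le_trans FE];
    apply: ereal_sup_ubound; [exists a|exists b].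
by apply/andP; split; apply: ge_ereal_sup => _ [a ? <-]; auto.
Qed.

Lemma hausdorff_dist_triangle E F G (r s : R) :
  (hausdorff_dist E F <= r%:E)%E -> (hausdorff_dist F G <= s%:E)%E ->
  (hausdorff_dist E G <= (r + s)%:E)%E.
Proof.
have half A B C (t u : R) :
    (forall a, A a -> (dist_to_set a B <= t%:E)%E) ->
    (forall a, B a -> (dist_to_set a C <= u%:E)%E) ->
    forall a, A a -> (dist_to_set a C <= (t + u)%:E)%E.
  move=> AB BC a Aa; apply/dist_to_set_leP => e e0.
  have e20 : 0 < e / 2 by rewrite divr_gt0.
  have [b Bb ab] := (dist_to_set_leP _ _ _).1 (AB _ Aa) _ e20.
  have [c Cc bc] := (dist_to_set_leP _ _ _).1 (BC _ Bb) _ e20.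
  exists c => //; apply: le_lt_trans (metric_triangle a b c) _.
  by rewrite [e]splitr addrACA ltrD.
move=> /hausdorff_dist_leP[EF FE] /hausdorff_dist_leP[FG GF].
apply/hausdorff_dist_leP; split; first exact: half EF FG.
by rewrite addrC; exact: half GF FE.
Qed.

Lemma compact_mdist_bounded x E : compact E ->
  exists r : R, forall y, E y -> mdist x y <= r.
Proof.
move=> /(compact_near_coveringP E).1 cE.
have H := cE R (+oo : set_system R) (fun r y => mdist x y <= r) _ _.
suff /H[r [_ Hr]] : forall y, E y ->
    \forall y' \near y & r \near +oo, mdist x y' <= r.
  by exists (r + 1) => y Ey; apply: Hr => //; rewrite ltrDl.
move=> y _; exists (ball y 1, [set r : R | mdist x y + 1 <= r]) => /=.
  by split; [exact: nbhsx_ballx|apply: nbhs_pinfty_ge; exact: num_real].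
move=> [z r] /= []; rewrite ballEmdist/= => yz xr.
apply: le_trans xr; apply: le_trans (metric_triangle x y z) _.
by rewrite lerD2l ltW.
Qed.

Lemma hausdorff_dist_fin_num E F : E !=set0 -> compact E ->
  F !=set0 -> compact F -> hausdorff_dist E F \is a fin_num.
Proof.
move=> E0 cE F0 cF; rewrite ge0_fin_numE ?hausdorff_dist_ge0//.
have [x Ex] := E0; have [y Fy] := F0.
have [r Er] := compact_mdist_bounded y cE.
have [s Fs] := compact_mdist_bounded x cF.
apply: (@le_lt_trans _ _ (Order.max r s)%:E); last exact: ltry.
apply/hausdorff_dist_leP; split=> [a Ea|b Fb].
  apply: (@le_trans _ _ (mdist a y)%:E).
    by apply: ereal_inf_lbound; exists y.
  by rewrite lee_fin metric_sym le_max Er.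
apply: (@le_trans _ _ (mdist b x)%:E).
  by apply: ereal_inf_lbound; exists x.
by rewrite lee_fin metric_sym le_max Fs ?orbT.
Qed.

Lemma hausdorff_dist_eq0 E F : compact E -> compact F ->
  hausdorff_dist E F = 0%E -> E = F.
Proof.
have half A B : compact B -> (forall a, A a -> (dist_to_set a B <= 0%:E)%E) ->
    A `<=` B.
  move=> cB AB a Aa.
  rewrite [B](closure_id _).1; last first.
    by apply: compact_closed => //; exact: metric_hausdorff.
  move=> V /nbhs_ballP[e /= e0 eV].
  have [b Bb ab] := (dist_to_set_leP _ _ _).1 (AB _ Aa) _ e0.
  exists b; split => //; apply: eV; rewrite ballEmdist/=.
  by rewrite add0r in ab.
move=> cE cF EF; have : (hausdorff_dist E F <= 0%:E)%E by rewrite EF.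
by move=> /hausdorff_dist_leP[? ?]; apply/seteqP; split; exact: half.
Qed.

End HausdorffDistance.

Record hyperspace (R : realType) (X : metricType R) := Hyperspace {
  hset :> set X ;
  hset_nonempty : hset !=set0 ;
  hset_compact : compact hset }.

HB.instance Definition _ (R : realType) (X : metricType R) :=
  gen_eqMixin (hyperspace X).
HB.instance Definition _ (R : realType) (X : metricType R) :=
  gen_choiceMixin (hyperspace X).

Section HyperspaceMetric.
Context {R : realType} {X : metricType R}.
Implicit Types E F G : hyperspace X.

Lemma hyperspace_eq E F : hset E = hset F -> E = F.
Proof.
case: E F => [E E0 cE] [F F0 cF] /= EF; subst F.
by congr Hyperspace; exact: Prop_irrelevance.
Qed.

(* The extended real below is finite, by hausdorff_dist_fin_num. *)
Definition hyperspace_dist E F : R := fine (hausdorff_dist E F).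

Lemma hyperspace_distE E F :
  (hyperspace_dist E F)%:E = hausdorff_dist E F.
Proof.
by rewrite fineK// hausdorff_dist_fin_num//;
  (exact: hset_nonempty || exact: hset_compact).
Qed.

Lemma hyperspace_distxx E : hyperspace_dist E E = 0.
Proof.
apply: EFin_inj; rewrite hyperspace_distE; apply/eqP; rewrite eq_le.
rewrite hausdorff_dist_ge0 ?andbT; last exact: hset_nonempty.
apply/hausdorff_dist_leP; split=> a Ea; apply/dist_to_set_leP => e e0;
  by exists a => //; rewrite mdistxx add0r.
Qed.

Lemma hyperspace_dist_positivity E F : hyperspace_dist E F = 0 -> E = F.
Proof.
move=> EF; apply/hyperspace_eq/hausdorff_dist_eq0; try exact: hset_compact.
by rewrite -hyperspace_distE EF.
Qed.

Lemma hyperspace_dist_sym E F : hyperspace_dist E F = hyperspace_dist F E.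
Proof. by rewrite /hyperspace_dist hausdorff_distC. Qed.

Lemma hyperspace_dist_triangle F E G :
  hyperspace_dist E G <= hyperspace_dist E F + hyperspace_dist F G.
Proof.
by rewrite -lee_fin hyperspace_distE;
  apply: hausdorff_dist_triangle; rewrite hyperspace_distE.
Qed.

HB.instance Definition _ := isMetric.Build R (hyperspace X)
  hyperspace_distxx hyperspace_dist_positivity hyperspace_dist_sym
  hyperspace_dist_triangle.

(* The cardinality bound [None] stands for infinity. *)
Definition card_bound (m : option nat) (E : set X) : Prop :=
  if m is Some k then (E #<= `I_k)%card else True.

Definition hyperspace_ml (m : option nat) (l : \bar R) : set (hyperspace X) :=
  [set E | card_bound m E /\ (diam E <= l)%E].

End HyperspaceMetric.

Definition isometric_embedding (R : realType) (Y Z : metricType R)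
    (f : Y -> Z) : Prop :=
  forall y y', mdist (f y) (f y') = mdist y y'.

(* Properties of a set A in a metric space M are those of the subspace A. *)
Section Subspaces.
Context {R : realType}.
Implicit Types (M : metricType R) (S T : set R).

Definition isometric M (N : metricType R) (A : set M) (B : set N) : Prop :=
  exists f : M -> N, set_bij A B f /\
    forall x y, A x -> A y -> mdist (f x) (f y) = mdist x y.

Definition range_set S : Prop := S 0 /\ forall r, S r -> 0 <= r.

Definition ultrametric M (A : set M) : Prop :=
  forall x y z, A x -> A y -> A z ->
    mdist x y <= Num.max (mdist x z) (mdist z y).

Definition valued_ultrametric S M (A : set M) : Prop :=
  ultrametric A /\ forall x y, A x -> A y -> S (mdist x y).

Definition finite_valued_ultrametric S (Y : metricType R) : Prop :=
  finite_set [set: Y] /\ valued_ultrametric S [set: Y].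

Definition class_injective (C : metricType R -> Prop) M (A : set M) : Prop :=
  A !=set0 /\
  forall (Y Z : metricType R) (phi : Y -> Z) (f : Y -> M),
    C Y -> C Z -> isometric_embedding phi ->
    isometric_embedding f -> (forall y, A (f y)) ->
    exists F : Z -> M, [/\ isometric_embedding F, forall z, A (F z)
                         & F \o phi = f].

Definition separable M (A : set M) : Prop :=
  exists D : set M, [/\ countable D, D `<=` A & A `<=` closure D].

Definition complete_subspace M (A : set M) : Prop :=
  forall u : nat -> M, (forall n, A (u n)) -> cauchy (u @ \oo) ->
    exists2 x, A x & u @ \oo --> x.

Definition separable_urysohn S M (A : set M) : Prop :=
  [/\ separable A, complete_subspace A,
      class_injective (finite_valued_ultrametric S) A
    & valued_ultrametric S A].

Definition semi_sporadic S : Prop :=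
  exists a : nat -> R, [/\ forall i, 0 < a i, decreasing_seq a,
    a @ \oo --> (0 : R) & S = [set 0] `|` range a].

Definition tenuous S : Prop := finite_set S \/ semi_sporadic S.

Definition TEN S : set (set R) :=
  [set T | [/\ range_set T, tenuous T & T `<=` S]].

(* A petal is a total function, whose values outside TEN S are irrelevant. *)
Definition is_petal S M (A : set M) (Pi : set R -> set M) : Prop :=
  [/\ forall T, TEN S T -> T <> [set 0] -> separable_urysohn T (Pi T),
      \bigcup_(T in TEN S) Pi T = A,
      forall T U, TEN S T -> TEN S U -> Pi T `&` Pi U = Pi (T `&` U)
    & forall T U x, TEN S T -> TEN S U -> Pi U x ->
        exists2 r, ([set 0] `|` (U `\` T)) r & dist_to_set x (Pi T) = r%:E].

Definition petaloid S M (A : set M) : Prop :=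
  valued_ultrametric S A /\ exists Pi, is_petal S A Pi.

Definition urysohn_universal S M (A : set M) : Prop :=
  (countable S -> separable_urysohn S A) /\ (~ countable S -> petaloid S A).

End Subspaces.

(* Main.v *)
Require Import Defs.
From HB Require Import structures.
From mathcomp Require Import all_boot all_order all_algebra.
From mathcomp Require Import all_classical all_reals all_analysis.
From mathcomp Require Import finmap lra.

(** Hyperspace: replacing each point of a maximal [r]-separated subset [N] of a
compact set [E] by a point at distance at most [r] produces a finite set at
Hausdorff distance at most [r] from [E], with no larger cardinality or
diameter.  Moving just one point of [N] realises any one-point extension of a
finite family of compact sets, which gives injectivity; the same device gives
separability and nearest points in the petals [{E | E ⊆ Π(X, S)}].

Uniqueness: in a [R]-Urysohn space choose, for every closed ball of radius
[r] in [R], one distinguished open [r]-ball inside it ("zero child"), and number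
the others by the positive integers.  Recording, for each [r], the number of the
open [r]-ball of [x] identifies the space with the functions [R \ 0 -> nat] with
tenuous support, where [d(f, g)] is the largest [r] such that [f r <> g r].
The only property of the choice that matters is that points lie in zero children
at all but tenuously many radii.  For countable [R], the zero child is the one
containing the first element, within the closed ball, of a dense sequence; for
uncountable [R], it is the one meeting a petal [Π(X, S)] with [r] not in [S]. *)

Set Implicit Arguments.
Unset Strict Implicit.
Unset Printing Implicit Defensive.

Import Order.TTheory GRing.Theory Num.Theory.
Import numFieldNormedType.Exports.

Local Open Scope classical_set_scope.
Local Open Scope ring_scope.

(** * Metric and ultrametric preliminaries *)

Lemma invSn_lt (R : realType) (e : R) : 0 < e ->
  exists N, forall n, (N <= n)%N -> n.+1%:R^-1 < e.
Proof.
move=> e0; exists (Num.truncn e^-1) => n Nn.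
have h : e^-1 < n.+1%:R.
  apply: (lt_le_trans (truncnS_gt _)); by rewrite ler_nat ltnS.
by rewrite -[ltRHS]invrK ltf_pV2 ?posrE ?invr_gt0 ?ltr0n.
Qed.

Lemma filter_finite_bigcap T (I : choiceType) (G : set_system T) (D : set I)
    (B : I -> set T) : Filter G -> finite_set D ->
  (forall i, D i -> G (B i)) -> G (\bigcap_(i in D) B i).
Proof. by move=> FG /finite_fsetP[E ->] GB; exact: filter_bigI. Qed.

Section MetricBasics.
Import metricType_numDomainType.
Context {R : realType} {M : metricType R}.
Implicit Types (x y z : M) (A D E F : set M) (u : nat -> M).

Lemma cvg_mdistP u x : u @ \oo --> x <->
  forall e : R, 0 < e -> exists N, forall n, (N <= n)%N -> mdist x (u n) < e.
Proof.
split=> [/cvgrPdist_lt H e /H [N _ HN]|H]; first by exists N => n /HN.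
by apply/cvgrPdist_lt => e /H[N HN]; exists N.
Qed.

Lemma cauchy_mdistP u : cauchy (u @ \oo) <->
  forall e : R, 0 < e ->
    exists N, forall n m, (N <= n)%N -> (N <= m)%N -> mdist (u n) (u m) < e.
Proof.
split=> [/cauchyP H e e0|H].
  have e20 : 0 < e / 2 by rewrite divr_gt0.
  have [y [N _ HN]] := H _ e20.
  exists N => n m /HN /=; rewrite ballEmdist /= => yn /HN /=.
  rewrite ballEmdist /= => ym; rewrite (le_lt_trans (metric_triangle _ y _))//.
  by rewrite (metric_sym _ y) [e]splitr ltrD.
apply/cauchy_ballP => e e0; have [N HN] := H e e0.
exists (u @` [set n | (N <= n)%N], u @` [set n | (N <= n)%N]) => /=.
  by split; exists N => // n Nn; exists n.
by move=> [_ _] [[n Nn <-] [k Nk <-]] /=; rewrite ballEmdist; apply: HN.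
Qed.

Lemma closure_mdistP D x : closure D x <->
  forall e : R, 0 < e -> exists2 y, D y & mdist x y < e.
Proof.
split=> [H e e0|H B /nbhs_ballP[e /= e0 eB]].
  have [y []] := H _ (nbhsx_ballx x _ e0).
  by rewrite ballEmdist => Dy xy; exists y.
by have [y Dy xy] := H e e0; exists y; split=> //; apply: eB; rewrite ballEmdist.
Qed.

(** Compactness is used along the filter of finite subsets of [E] directed by inclusion: the ball of
    [x] is handled once the subset contains [x]. *)
Lemma compact_finite_net E : compact E -> forall e : R, 0 < e ->
  exists F, [/\ finite_set F, F `<=` E &
    forall x, E x -> exists2 y, F y & mdist x y < e].
Proof.
move=> /(compact_near_coveringP E).1 cE e e0.
pose fin := [set D : set M | finite_set D /\ D `<=` E].
pose G := filter_from fin (fun D0 => [set D | fin D /\ D0 `<=` D]).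
have FG : Filter G.
  apply: filter_from_filter; first by exists set0; split=> //; exact: finite_set0.
  move=> D1 D2 [f1 s1] [f2 s2]; exists (D1 `|` D2).
    by split; [rewrite finite_setU|rewrite subUset; split].
  by move=> D /= [fD]; rewrite subUset => -[].
have [|D0 fD0 HD0] :=
    cE (set M) G (fun D x => exists2 y, D y & mdist x y < e) FG.
  move=> x Ex; exists (ball x e, [set D | fin D /\ [set x] `<=` D]) => /=.
    split; first exact: nbhsx_ballx.
    by exists [set x] => //; split; [exact: finite_set1|move=> _ ->].
  move=> [x' D] /= []; rewrite ballEmdist /= => xx' [_ /(_ x erefl) Dx].
  by exists x => //; rewrite metric_sym.
have [fD0' D0E] := fD0.
by exists D0; split=> // x Ex; have := HD0 D0 (conj fD0 (@subset_refl _ _)) x Ex.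
Qed.

(** A witness for [y] keeps half its slack near [y], and compactness makes the slack uniform. This
    turns strict pointwise bounds into a strict Hausdorff bound. *)
Lemma compact_uniform_lt E F (t : R) : compact E ->
  (forall a, E a -> exists2 b, F b & mdist a b < t) ->
  exists2 e : R, 0 < e & forall a, E a -> exists2 b, F b & mdist a b <= t - e.
Proof.
move=> /(compact_near_coveringP E).1 cE H.
have K := cE R (0^'+) (fun e y => exists2 b, F b & mdist y b <= t - e) _ _.
suff /K [e /= e0 He] : forall y, E y -> \forall y' \near y & e \near 0^'+,
    exists2 b, F b & mdist y' b <= t - e.
  exists (e / 2); first by rewrite divr_gt0.
  move=> a Ea; apply: (He (e / 2)) => //=; last by rewrite divr_gt0.
  rewrite sub0r normrN gtr0_norm ?divr_gt0//.
  by rewrite ltr_pdivrMr// ltr_pMr// ltr1n.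
move=> y Ey; have [b Fb yb] := H y Ey.
pose dl := (t - mdist y b) / 2; have dl0 : 0 < dl by rewrite /dl; lra.
exists (ball y dl, [set e : R | e <= dl]) => /=.
  by split; [exact: nbhsx_ballx|apply: nbhs_right_le].
move=> [y' e] /= []; rewrite ballEmdist /= => yy' edl; exists b => //.
have := metric_triangle y' y b; rewrite (metric_sym y' y) => h.
by move: h yy' edl; rewrite /dl; lra.
Qed.

(** If all points were farther than [r], compactness would make the excess over [r] uniform, against
    the bound on the infimum. *)
Lemma compact_mdist_attained E x (r : R) : compact E ->
  (dist_to_set x E <= r%:E)%E -> exists2 a, E a & mdist x a <= r.
Proof.
move=> /(compact_near_coveringP E).1 cE /dist_to_set_leP H.
apply: contrapT => C.
have far a : E a -> r < mdist x a.
  by move=> Ea; rewrite ltNge; apply/negP => h; apply: C; exists a.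
have K := cE R (0^'+) (fun e y => r + e <= mdist x y) _ _.
suff /K [e /= e0 He] : forall y, E y -> \forall y' \near y & e \near 0^'+,
    r + e <= mdist x y'.
  have e20 : 0 < e / 2 by rewrite divr_gt0.
  have [a Ea] := H _ e20; rewrite ltNge => /negP; apply; apply: He => //=.
  by rewrite sub0r normrN gtr0_norm// ltr_pdivrMr// ltr_pMr// ltr1n.
move=> y /far xy.
pose dl := (mdist x y - r) / 2; have dl0 : 0 < dl by rewrite /dl; lra.
exists (ball y dl, [set e : R | e <= dl]) => /=.
  by split; [exact: nbhsx_ballx|apply: nbhs_right_le].
move=> [y' e] /= []; rewrite ballEmdist /= => yy' edl.
have := metric_triangle x y' y; rewrite (metric_sym y' y) => h.
by move: h yy' edl; rewrite /dl; lra.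
Qed.

Lemma ultrafilter_finite_cover (G : set_system M) F (B : M -> set M) :
  UltraFilter G -> finite_set F -> G (\bigcup_(y in F) B y) ->
  exists2 y, F y & G (B y).
Proof.
move=> UG finF GB; apply: contrapT => C.
have nB y : F y -> G (~` B y).
  move=> Fy; have [GBy|//] := in_ultra_setVsetC (B y) UG.
  by exfalso; apply: C; exists y.
have GI : G (\bigcap_(y in F) ~` B y).
  exact: filter_finite_bigcap.
have [z [[y Fy By] /(_ y Fy)]] := filter_ex (filterI GB GI).
exact.
Qed.

(** An ultrafilter containing [E] contains a ball of each radius [1 / (n + 1)]. Points [u n] of [E]
    common to the first [n + 1] balls form a Cauchy sequence, and its limit is a limit of the
    ultrafilter. *)
Lemma totally_bounded_compact A E : complete_subspace A -> E `<=` A ->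
  (forall x, A x -> closure E x -> E x) ->
  (forall e : R, 0 < e -> exists2 F, finite_set F &
     forall x, E x -> exists2 y, F y & mdist x y < e) ->
  compact E.
Proof.
move=> cA EA clE tb; rewrite compact_ultra => G UG GE.
have ballG (n : nat) : exists y, G (ball y n.+1%:R^-1).
  have [|F finF cov] := tb n.+1%:R^-1; first by rewrite invr_gt0.
  have [|y _ Gy] :=
      @ultrafilter_finite_cover G F (fun y => ball y n.+1%:R^-1) UG finF.
    apply: filterS GE => x /cov[y Fy xy]; exists y => //.
    by rewrite ballEmdist /= metric_sym.
  by exists y.
have [y Gy] := choice ballG.
have GI n : G (E `&` \bigcap_(k in `I_n.+1) ball (y k) k.+1%:R^-1).
  apply: filterI => //.
  by apply: filter_finite_bigcap => // k _; exact: Gy.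
have [u Hu] := choice (fun n => filter_ex (GI n)).
have uE n : E (u n) by have [] := Hu n.
have uy n k : (k <= n)%N -> mdist (y k) (u n) < k.+1%:R^-1.
  by move=> kn; have [_ /(_ k)] := Hu n; rewrite ballEmdist; apply.
have [|x Ax ux] := cA u (fun n => EA _ (uE n)).
  apply/cauchy_mdistP => e e0.
  have [N HN] : exists N, forall n, (N <= n)%N -> n.+1%:R^-1 < e / 2.
    by apply: invSn_lt; rewrite divr_gt0.
  exists N => n m Nn Nm.
  rewrite (le_lt_trans (metric_triangle _ (y N) _))// [e]splitr metric_sym ltrD//.
    by rewrite (lt_trans (uy _ _ Nn))// HN.
  by rewrite (lt_trans (uy _ _ Nm))// HN.
exists x; split.
  apply: clE => //; apply/closure_mdistP => e e0.
  by have [N /(_ N (leqnn _))] := (cvg_mdistP _ _).1 ux e e0; exists (u N).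
move=> V /nbhs_ballP[e /= e0 eV].
have e30 : 0 < e / 3 by rewrite divr_gt0.
have [N HN] := invSn_lt e30; have [N' HN'] := (cvg_mdistP _ _).1 ux _ e30.
apply: filterS (Gy N) => z; rewrite ballEmdist /= => yz; apply: eV.
rewrite ballEmdist /=.
have h1 := HN' (maxn N N') (leq_maxr _ _).
have h2 := uy (maxn N N') N (leq_maxl _ _).
have h3 := HN N (leqnn _).
have := metric_triangle x (u (maxn N N')) z.
have := metric_triangle (u (maxn N N')) (y N) z.
rewrite (metric_sym (u (maxn N N')) (y N)).
by move: h1 h2 h3 yz; move: N.+1%:R^-1 => q; lra.
Qed.

Lemma complete_subspace_closed A x : complete_subspace A -> closure A x -> A x.
Proof.
move=> cA /closure_mdistP clx.
have /choice[u uP] (n : nat) : exists y, A y /\ mdist x y < n.+1%:R^-1.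
  by have [|y] := clx n.+1%:R^-1; [rewrite invr_gt0|exists y].
have small (e : R) : 0 < e -> exists N, forall n, (N <= n)%N -> mdist x (u n) < e.
  by move=> /invSn_lt[N HN]; exists N => n /HN; exact: lt_trans (uP n).2.
have ux : u @ \oo --> x by apply/cvg_mdistP.
have [||z Az uz] := cA u; first by move=> n; exact: (uP n).1.
  apply/cauchy_mdistP => e e0; have [N HN] := small _ (divr_gt0 e0 (ltr0Sn R 1)).
  exists N => n k Nn Nk; rewrite (le_lt_trans (metric_triangle _ x _))//.
  by rewrite [e]splitr metric_sym ltrD// HN.
by rewrite (cvg_unique (@metric_hausdorff _ M) ux uz).
Qed.

End MetricBasics.

Section Ultrametric.
Context {R : realType} {M : metricType R}.
Variable A : set M.
Hypothesis uA : ultrametric A.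
Implicit Types x y z : M.

Lemma ultra_le z x y (r : R) : A z -> A x -> A y ->
  mdist x z <= r -> mdist z y <= r -> mdist x y <= r.
Proof.
by move=> Az Ax Ay xz zy; rewrite (le_trans (uA Ax Ay Az))// ge_max xz.
Qed.

Lemma ultra_lt z x y (r : R) : A z -> A x -> A y ->
  mdist x z < r -> mdist z y < r -> mdist x y < r.
Proof.
by move=> Az Ax Ay xz zy; rewrite (le_lt_trans (uA Ax Ay Az))// gt_max xz.
Qed.

End Ultrametric.

(** * Injectivity and one-point extensions *)

Lemma finite_set_argmin (R : realType) (T : Type) (D : set T) (f : T -> R) :
  finite_set D -> D !=set0 -> exists2 p, D p & forall x, D x -> f p <= f x.
Proof.
elim/Pchoice: T => T in D f * => /finite_fsetP[E ->] [x0 Ex0].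
pose F (i : E) := f (val i).
case: (arg_minP F (erefl (predT [` Ex0]%fset))) => p _ pmin.
exists (val p); first exact: valP.
by move=> x Ex; exact: (pmin [` Ex]%fset).
Qed.

Section UltrametricType.
Context {R : realType} {T : choiceType} (dst : T -> T -> R).
Hypotheses (dxx : forall x, dst x x = 0)
  (d_eq0 : forall x y, dst x y = 0 -> x = y)
  (dC : forall x y, dst x y = dst y x)
  (dU : forall x y z, dst x y <= Num.max (dst x z) (dst z y)).

Let d_triangle y x z : dst x z <= dst x y + dst y z.
Proof.
have d_ge0 u v : 0 <= dst u v.
  by have := dU u u v; rewrite dxx (dC v u) maxxx.
by apply: (le_trans (dU _ _ y)); rewrite ge_max lerDl lerDr !d_ge0.
Qed.

Let carrier : Type := T.

#[local] HB.instance Definition _ := Choice.on carrier.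
#[local] HB.instance Definition _ :=
  isMetric.Build R carrier dxx d_eq0 dC d_triangle.

(** Injectivity quantifies over bundled metric types, so a distance given by a formula has to be
    packaged as one. *)
Lemma ultrametric_type : exists (Z : metricType R) (f : T -> Z) (g : Z -> T),
  [/\ cancel f g, cancel g f & forall x y, mdist (f x) (f y) = dst x y].
Proof. by exists carrier, id, id. Qed.

End UltrametricType.

Section Injectivity.
Context {R : realType} {M : metricType R}.
Variables (S : set R) (A : set M).

(* In an ultrametric space every one-point extension of a finite subspace has
   this form: [p] is a point nearest to the new point [z], and [r] its distance. *)
Definition one_point_injective := forall (F : set M) p r,
  finite_set F -> F `<=` A -> A p -> S r -> 0 < r ->
  exists2 z, A z & forall x, F x -> mdist z x = Num.max r (mdist p x).

Lemma one_point_injectiveW :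
  (forall (F : set M) p r, finite_set F -> F `<=` A -> F p -> S r -> 0 < r ->
    exists2 z, A z & forall x, F x -> mdist z x = Num.max r (mdist p x)) ->
  one_point_injective.
Proof.
move=> H F p r finF FA Ap Sr r0.
have [|||z Az zF] := H (p |` F) p r _ _ _ Sr r0.
- by rewrite finite_setU; split=> //; exact: finite_set1.
- by move=> x [->|/FA].
- by left.
by exists z => // x Fx; apply: zF; right.
Qed.

(** The formula [max r (d p x)] extends the ultrametric of [F] to one more point, encoded as [None].
    Values stay in [S], and [r > 0] keeps the new point apart from the others. *)
Lemma class_injective_one_point : range_set S -> valued_ultrametric S A ->
  class_injective (finite_valued_ultrametric S) A -> one_point_injective.
Proof.
move=> [S0 _] [uA SA] [_ injA]; apply: one_point_injectiveW.
move=> F p r /finite_fsetP[D ->] DA Dp Sr r0.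
have Av (x : D) : A (val x) by apply: DA; exact: valP.
have [||||Y [fY [gY [fK gK dY]]]] :=
    @ultrametric_type R D (fun x y => mdist (val x) (val y)).
- by move=> x; exact: mdistxx.
- by move=> x y /mdist_positivity/val_inj.
- by move=> x y; exact: metric_sym.
- by move=> x y z; exact: uA.
pose q (x : D) := Num.max r (mdist p (val x)).
have Ap : A p by exact: DA.
have q0 x : 0 < q x by rewrite lt_max r0.
pose dst (x y : option D) := match x, y with
  | Some x, Some y => mdist (val x) (val y)
  | Some x, None => q x | None, Some y => q y | None, None => 0 end.
have dstU x y z : dst x y <= Num.max (dst x z) (dst z y).
  move: x y z => [x|] [y|] [z|] /=; rewrite /q ?ge_max ?le_max ?lexx ?orbT ?mdist_ge0//=.
  + by have := uA _ _ _ (Av x) (Av y) (Av z); rewrite le_max.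
  + have := uA _ _ _ (Av x) (Av y) Ap; rewrite le_max (metric_sym (val x) p).
    by move=> /orP[] ->; rewrite ?orbT.
  + have := uA _ _ _ (Av x) Ap (Av z).
    rewrite le_max (metric_sym (val x) p) (metric_sym (val z) p).
    by move=> /orP[] ->; rewrite ?orbT.
  + have := uA _ _ _ Ap (Av y) (Av z); rewrite le_max.
    by move=> /orP[] ->; rewrite ?orbT.
  + by rewrite ltW.
have [|||| Z [fZ [gZ [fZK gZK dZ]]]] := @ultrametric_type R (option D) dst.
- by case=> //= x; exact: mdistxx.
- move=> [x|] [y|] //=.
  + by move=> /mdist_positivity/val_inj ->.
  + by move=> h; have := q0 x; rewrite h ltxx.
  + by move=> h; have := q0 y; rewrite h ltxx.
- by move=> [x|] [y|] //=; exact: metric_sym.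
- exact: dstU.
have finT (T : finType) (W : metricType R) (f : T -> W) g :
    cancel g f -> finite_set [set: W].
  move=> gK'; have -> : [set: W] = f @` [set: T].
    by apply/seteqP; split=> // w _; exists (g w).
  by apply: finite_image; apply: finite_finset.
have Sq x : S (q x) by rewrite /q; case: leP => // _; exact: SA.
have SY : finite_valued_ultrametric S Y.
  split; first exact: finT gK.
  split=> [x y z _ _ _|x y _ _].
    by rewrite -(gK x) -(gK y) -(gK z) !dY; exact: uA.
  by rewrite -(gK x) -(gK y) !dY; exact: SA.
have SZ : finite_valued_ultrametric S Z.
  split; first exact: finT gZK.
  split=> [x y z _ _ _|x y _ _].
    by rewrite -(gZK x) -(gZK y) -(gZK z) !dZ; exact: dstU.
  rewrite -(gZK x) -(gZK y) !dZ.
  by case: (gZ x) (gZ y) => [a|] [b|] //=; exact: (SA _ _ (Av a) (Av b)).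
have [||y|G [dG AG GE]] :=
    injA Y Z (fun y => fZ (Some (gY y))) (fun y => val (gY y)) SY SZ.
- by move=> y y'; rewrite dZ /= -dY !gK.
- by move=> y y'; rewrite -dY !gK.
- exact: Av.
exists (G (fZ None)) => // x Dx.
have GS (t : D) : G (fZ (Some t)) = val t.
  by have /= := congr1 (fun h => h (fY t)) GE; rewrite fK.
by have := dG (fZ None) (fZ (Some [` Dx]%fset)); rewrite GS dZ.
Qed.

(** The points of the finite space [Z] are added one at a time to the range of [phi], each through a
    nearest point already placed. *)
Lemma one_point_class_injective : A !=set0 -> one_point_injective ->
  class_injective (finite_valued_ultrametric S) A.
Proof.
move=> [a Aa] injA; split; first by exists a.
move=> Y Z phi f [finY SY] [finZ [uZ SZ]] iphi if_ Af.
have [s0 s0Z] : exists s : seq Z, forall z, z \in s.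
  have [s sE] := (finite_seqP _).1 finZ; exists s => z.
  by have : [set` s] z by rewrite -sE.
suff [F [AF Ff dF]] : exists F : Z -> M, [/\ forall z, A (F z), F \o phi = f
    & forall z z', (range phi z \/ z \in s0) -> (range phi z' \/ z' \in s0) ->
      mdist (F z) (F z') = mdist z z'].
  by exists F; split=> // z z'; apply: dF; right; exact: s0Z.
clear s0Z.
elim: s0 => [|z0 s [F [AF Ff dF]]].
  (* The value [a] is a default: at the start only the range of [phi] matters. *)
  pose F z := if pselect (range phi z) is left h then f (projT1 (cid2 h)) else a.
  have Fphi y : F (phi y) = f y.
    rewrite /F; case: pselect => [h|[]]; last by exists y.
    case: (cid2 h) => y' _ /= e; apply: mdist_positivity.
    by rewrite if_ -iphi e mdistxx.
  exists F; split.
  - by move=> z; rewrite /F; case: pselect.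
  - exact/funext.
  - by move=> _ _ [[y _ <-]|//] [[y' _ <-]|//]; rewrite !Fphi if_ iphi.
pose D := [set z | range phi z \/ z \in s].
have [Dz0|nDz0] := pselect (D z0).
  exists F; split=> // z z' hz hz'; apply: dF.
    by case: hz => [|]; [left|rewrite inE => /orP[/eqP ->|]; [|right]].
  by case: hz' => [|]; [left|rewrite inE => /orP[/eqP ->|]; [|right]].
have D1 z : range phi z \/ z \in z0 :: s -> z = z0 \/ D z.
  by rewrite inE => -[?|/orP[/eqP|?]]; [right; left|left|right; right].
have finD : finite_set D by apply: sub_finite_set finZ.
have [D0|/set0P [p0 Dp0]] := eqVneq D set0.
  exists F; split=> // z z' /D1[->|]; rewrite ?D0// => /D1[->|]; rewrite ?D0//.
  by rewrite !mdistxx.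
have [p Dp pmin] := finite_set_argmin (mdist z0) finD (ex_intro _ _ Dp0).
have r0 : 0 < mdist z0 p.
  by rewrite mdist_gt0; apply/eqP => e; apply: nDz0; rewrite e.
have [||w Aw dw] := @injA (F @` D) (F p) (mdist z0 p) _ _ (AF p) (SZ _ _ I I) r0.
- exact: finite_image.
- by move=> _ [z _ <-].
have dz z : D z -> mdist w (F z) = mdist z0 z.
  move=> Dz; rewrite dw; last by exists z.
  rewrite (dF _ _ Dp Dz); apply/eqP; rewrite eq_le ge_max pmin//=.
  rewrite uZ// andbT; apply: (le_trans (uZ _ _ z0 I I I)).
  by rewrite (metric_sym p) ge_max pmin//=.
exists (fun z => if z == z0 then w else F z); split.
- by move=> z; case: eqP.
- apply/funext => y /=; case: eqP => [e|_]; last by rewrite -Ff.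
  by case: nDz0; left; exists y.
- move=> z z' /D1 hz /D1 hz'.
  case: eqP => [->|nz]; case: eqP => [->|nz'].
  + by rewrite !mdistxx.
  + by case: hz' => // /dz.
  + by case: hz => // /dz; rewrite metric_sym (metric_sym z).
  + by case: hz => // Dz; case: hz' => // Dz'; exact: dF.
Qed.

End Injectivity.

(** * The Hausdorff metric on compact subsets of an ultrametric space *)

Section Hyperspace.
Context {R : realType} {M : metricType R}.
Implicit Types (E F G : hyperspace M) (r : R).

(** Compactness makes the infima attained, so a Hausdorff bound can be read on points with no
    margin. *)
Lemma hyper_mdist_leP E F r : mdist E F <= r <->
  (forall a, hset E a -> exists2 b, hset F b & mdist a b <= r) /\
  (forall b, hset F b -> exists2 a, hset E a & mdist b a <= r).
Proof.
rewrite -lee_fin (_ : (mdist E F)%:E = hausdorff_dist E F); last first.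
  exact: hyperspace_distE.
rewrite hausdorff_dist_leP; split=> -[h1 h2]; split.
- by move=> a /h1; apply: compact_mdist_attained; exact: hset_compact.
- by move=> a /h2; apply: compact_mdist_attained; exact: hset_compact.
- move=> a /h1[b Fb ab]; apply: (@le_trans _ _ (mdist a b)%:E) => //.
  by apply: ereal_inf_lbound; exists b.
- move=> b /h2[a Ea ab]; apply: (@le_trans _ _ (mdist b a)%:E) => //.
  by apply: ereal_inf_lbound; exists a.
Qed.

Lemma hyper_mdist_lt E F r :
  (forall a, hset E a -> exists2 b, hset F b & mdist a b < r) ->
  (forall b, hset F b -> exists2 a, hset E a & mdist b a < r) -> mdist E F < r.
Proof.
move=> /(compact_uniform_lt (@hset_compact _ _ E)) [e e0 He].
move=> /(compact_uniform_lt (@hset_compact _ _ F)) [e' e0' He'].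
apply: (@le_lt_trans _ _ (r - Num.min e e')).
  apply/hyper_mdist_leP; split=> [a /He|b /He'] [c ? h]; exists c => //;
  by apply: (le_trans h); rewrite lerD2l lerN2 ge_min lexx ?orbT.
by rewrite ltrBlDr ltrDl lt_min e0.
Qed.

(** The hyperspace of a subspace is cut out of that of [M], so that those of different petals lie in
    one metric space. *)
Definition hyperspace_in m l (A : set M) : set (hyperspace M) :=
  @hyperspace_ml R M m l `&` [set E | hset E `<=` A].

Lemma hyperspace_inT m l : hyperspace_in m l setT = @hyperspace_ml R M m l.
Proof. by apply/seteqP; split=> [E []//|E h]; split. Qed.

Variables (m : option nat) (l : \bar R) (A : set M).
Hypothesis uA : ultrametric A.
Local Notation K := (hyperspace_in m l A).

Lemma hyperspace_ultrametric : ultrametric K.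
Proof.
move=> E F G [_ EA] [_ FA] [_ GA].
have /hyper_mdist_leP[EG GE] := lexx (mdist E G).
have /hyper_mdist_leP[GF FG] := lexx (mdist G F).
apply/hyper_mdist_leP; split.
- move=> a Ea; have [c Gc ac] := EG a Ea; have [b Fb cb] := GF c Gc.
  exists b => //; apply: (le_trans (uA (EA _ Ea) (FA _ Fb) (GA _ Gc))).
  by rewrite ge_max !le_max ac cb orbT.
- move=> b Fb; have [c Gc ac] := FG b Fb; have [a Ea cb] := GE c Gc.
  exists a => //; apply: (le_trans (uA (FA _ Fb) (EA _ Ea) (GA _ Gc))).
  by rewrite ge_max !le_max ac cb orbT.
Qed.

Lemma hyperspace_valued (S : set R) : S 0 ->
  (forall x y, A x -> A y -> S (mdist x y)) ->
  forall E F, K E -> K F -> S (mdist E F).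
Proof.
move=> S0 SA E F [_ EA] [_ FA]; apply: contrapT => nS.
(* If the Hausdorff distance is not in [S], no distance between points equals
   it, so all the bounds between points are strict, hence so is the Hausdorff
   bound, by compactness. *)
have /hyper_mdist_leP[EF FE] := lexx (mdist E F).
suff : mdist E F < mdist E F by rewrite ltxx.
apply: hyper_mdist_lt.
- move=> a Ea; have [b Fb ab] := EF a Ea; exists b => //.
  rewrite lt_neqAle ab andbT; apply/eqP => e; apply: nS; rewrite -e.
  by apply: SA; [exact: EA|exact: FA].
- move=> b Fb; have [a Ea ab] := FE b Fb; exists a => //.
  rewrite lt_neqAle ab andbT; apply/eqP => e; apply: nS; rewrite -e.
  by apply: SA; [exact: FA|exact: EA].
Qed.

Lemma diam_ge0 (D : set M) : D !=set0 -> (0 <= diam D)%E.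
Proof.
by move=> [x Dx]; apply: ereal_sup_ubound; exists x => //; exists x; rewrite ?mdistxx.
Qed.

Lemma diam_ub (D : set M) x y : D x -> D y -> ((mdist x y)%:E <= diam D)%E.
Proof. by move=> Ex Ey; apply: ereal_sup_ubound; exists x => //; exists y. Qed.

(** Being within [r] is an equivalence relation on [E]; [N] has one point per class, hence is finite
    by compactness. Moving its points by at most [r] cannot increase the diameter, as distinct ones
    are more than [r] apart. *)
Lemma hyperspace_discretize E r : K E -> 0 < r -> exists N : set M,
  [/\ finite_set N, N `<=` E, (forall x, hset E x -> exists2 y, N y & mdist x y <= r),
      (forall x y, N x -> N y -> mdist x y <= r -> x = y)
    & forall g : M -> M, (forall x, N x -> A (g x) /\ mdist x (g x) <= r) ->
      exists F, [/\ hset F = g @` N, K F & mdist E F <= r]].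
Proof.
move=> [[Em El] EA] r0.
have [x0 Ex0] := hset_nonempty E.
(* [xget] depends only on the given set, and points of [E] within [r] of each other give the same
   set, hence the same representative. *)
pose c x := xget x0 [set y | hset E y /\ mdist x y <= r].
have cP x : hset E x -> hset E (c x) /\ mdist x (c x) <= r.
  move=> Ex; apply: (@xgetPex _ x0 [set y | hset E y /\ mdist x y <= r]).
  by exists x; split=> //; rewrite mdistxx ltW.
have cE x y : hset E x -> hset E y -> mdist x y <= r -> c x = c y.
  move=> Ex Ey xy; rewrite /c; congr xget.
  apply/seteqP; split=> z /= [Ez h]; split=> //.
    by apply: (ultra_le uA (EA _ Ex) (EA _ Ey) (EA _ Ez)); rewrite // metric_sym.
  by apply: (ultra_le uA (EA _ Ey) (EA _ Ex) (EA _ Ez)).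
have [F0 [finF0 F0E F0cov]] := compact_finite_net (@hset_compact _ _ E) r0.
have NE : c @` E `<=` E by move=> _ [x Ex <-]; exact: (cP x Ex).1.
have finN : finite_set (c @` E).
  apply: (sub_finite_set _ (finite_image c finF0)) => _ [x Ex <-].
  have [y F0y xy] := F0cov x Ex; exists y => //; apply/esym/cE => //.
    exact: F0E.
  exact: ltW.
have Nsep x y : (c @` E) x -> (c @` E) y -> mdist x y <= r -> x = y.
  move=> [{}x Ex <-] [{}y Ey <-] xy.
  have cc z : hset E z -> c (c z) = c z.
    by move=> Ez; have [? ?] := cP z Ez; apply/esym/cE.
  rewrite -(cc x Ex) -(cc y Ey); apply: cE => //; first exact: (cP x Ex).1.
  exact: (cP y Ey).1.
exists (c @` E); split=> //.
- by move=> x Ex; exists (c x); [exists x|exact: (cP x Ex).2].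
- move=> g gP.
  set N := c @` E in NE gP *.
  have Ncov x : hset E x -> exists2 y, N y & mdist x y <= r.
    by move=> Ex; exists (c x); [exists x|exact: (cP x Ex).2].
  have F1 : g @` N !=set0 by exists (g (c x0)), (c x0) => //; exists x0.
  have F2 : compact (g @` N) by apply/finite_compact/finite_image.
  exists (Hyperspace F1 F2); split=> //; first split; first split.
  + case: m Em => //= k; apply: card_le_trans.
    exact: card_le_trans (card_image_le _ _) (subset_card_le NE).
  + apply: le_trans El; apply: ge_ereal_sup => _ [_ [a Na <-]] [_ [b Nb <-]] <-.
    have [Aga aga] := gP a Na; have [Agb bgb] := gP b Nb.
    have Ea := NE _ Na; have Eb := NE _ Nb.
    have [->|ab] := eqVneq a b; first by rewrite mdistxx diam_ge0//; exists x0.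
    apply: le_trans (diam_ub Ea Eb); rewrite lee_fin.
    have rab : r <= mdist a b.
      by rewrite leNgt; apply/negP => /ltW/(Nsep _ _ Na Nb) e; rewrite e eqxx in ab.
    apply: (ultra_le uA (EA _ Ea)) => //.
      by rewrite metric_sym (le_trans aga).
    by apply: (ultra_le uA (EA _ Eb)) => //; [exact: EA|rewrite (le_trans bgb)].
  + by move=> _ [x Nx <-]; exact: (gP x Nx).1.
  + apply/hyper_mdist_leP; split=> [a Ea|_ [b Nb <-]].
      have [b Nb ab] := Ncov a Ea; exists (g b); first by exists b.
      have [? ?] := gP b Nb; apply: (ultra_le uA (EA _ (NE _ Nb))) => //.
      exact: EA.
    by exists b; [exact: NE|rewrite metric_sym; exact: (gP b Nb).2].
Qed.

End Hyperspace.

(** * Separability and injectivity of hyperspaces *)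

Section HyperspaceUrysohn.
Context {R : realType} {M : metricType R}.
Variables (m : option nat) (l : \bar R) (S : set R) (A : set M).
Hypotheses (hm : forall k, m = Some k -> (2 <= k)%N) (hl : (0 < l)%E).
Hypothesis uA : ultrametric A.
Local Notation K := (hyperspace_in m l A).

Lemma hyperspace_set1 a : A a -> exists2 E : hyperspace M, hset E = [set a] & K E.
Proof.
move=> Aa; have a0 : [set a] !=set0 by exists a.
exists (Hyperspace a0 (@compact_set1 _ a)) => //; split=> [|x /= ->//].
split.
  case: m hm => // k /(_ k erefl) k2 /=.
  have -> : [set a] = (fun=> a) @` `I_1.
    by apply/seteqP; split=> [x ->|x [_ _ <-]]//; exists 0%N.
  by apply: card_le_trans (card_image_le _ _) _; rewrite card_le_II ltnW.
apply: ge_ereal_sup => _ [_ /= -> [_ /= -> <-]]; rewrite mdistxx; exact: ltW.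
Qed.

(** Finite subsets of [D] are dense: discretize at scale [e / 2] and move the points of the net into
    [D]. *)
Lemma hyperspace_separable : separable A -> separable K.
Proof.
move=> [D [cD DA AD]].
pose DD := [set E : hyperspace M | K E /\ (finite_set (hset E) /\ hset E `<=` D)].
exists DD; split=> [|E []//|E KE].
  have inj : {in DD &, injective (@hset R M)}.
    by move=> E F _ _; exact: hyperspace_eq.
  rewrite -(eq_countable (inj_card_eq inj)).
  apply: sub_countable (countable_finite_subset cD).
  by apply: subset_card_le => _ [E [_ [? ?]] <-]; split.
apply/closure_mdistP => e e0; have e20 : 0 < e / 2 by rewrite divr_gt0.
have [N [finN NE _ _ H]] := hyperspace_discretize uA KE e20.
have /choice[g gP] x : exists y, hset E x -> D y /\ mdist x y < e / 2.
  have [Ex|] := pselect (hset E x); last by exists x.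
  have [y Dy xy] := (closure_mdistP D x).1 (AD _ (KE.2 _ Ex)) _ e20.
  by exists y.
have [|F [FE KF EF]] := H g.
  move=> x /NE /gP [Dg /ltW]; split=> //; exact: DA.
exists F; last by apply: (le_lt_trans EF); lra.
split=> //; rewrite FE; split; first exact: finite_image.
by move=> _ [x /NE /gP [? _] <-].
Qed.

(** A single point [q], at distance at least [r] from every member of [FF], replaces a point [p] in
    a discretization of [P]. The new set is within [r] of [P] and at least [r] from each [E], and
    the ultrametric inequality does the rest. *)
Lemma hyperspace_one_point_injective :
  one_point_injective S A -> one_point_injective S K.
Proof.
move=> injA; apply: one_point_injectiveW => FF P r finFF FFK FFP Sr r0.
have KP := FFK _ FFP.
have [N [finN NP Ncov _ H]] := hyperspace_discretize uA KP r0.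
have [x1 Px1] := hset_nonempty P; have [p Np _] := Ncov _ Px1.
have Ap : A p by apply: KP.2; exact: NP.
have /choice[net netP] (E : hyperspace M) :=
  compact_finite_net (@hset_compact _ _ E) r0.
have [||q Aq dq] := injA (\bigcup_(E in FF) net E) p r _ _ Ap Sr r0.
- by apply: bigcup_finite => // E _; have [] := netP E.
- move=> x [E FE Ex]; have [_ h _] := netP E.
  by apply: (FFK _ FE).2; exact: h.
(* A net of mesh [r] controls all of [E]: a point of [E] nearer than [r] to [q] would bring its net
   point nearer than [r] too. *)
have dqE E x : FF E -> hset E x -> r <= mdist q x.
  move=> FE Ex; have [_ netE cov] := netP E; have [y Ny xy] := cov _ Ex.
  have Ay : A y by apply: (FFK _ FE).2; exact: netE.
  have Ax : A x by apply: (FFK _ FE).2.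
  have rq : r <= mdist q y by rewrite dq; [rewrite le_max lexx|exists E].
  rewrite leNgt; apply/negP => qx; move: rq; rewrite leNgt => /negP; apply.
  exact: (ultra_lt uA Ax).
have [|F [FE KF PF]] := H (fun x => if x == p then q else x).
  move=> x Nx; case: eqP => [->|_]; last first.
    by rewrite mdistxx ltW//; split=> //; apply: KP.2; exact: NP.
  split=> //; have [_ netE cov] := netP P; have [y Ny xy] := cov _ (NP _ Np).
  have Ay : A y by apply: KP.2; exact: netE.
  apply: (ultra_le uA Ay) => //; first exact: ltW.
  rewrite metric_sym dq; last by exists P.
  by rewrite ge_max lexx ltW.
exists F => // E FFE; have KE := FFK _ FFE.
have Fq : hset F q by rewrite FE; exists p => //; rewrite eqxx.
have rFE : r <= mdist F E.
  have [/(_ _ Fq)[b Eb qb] _] := (hyper_mdist_leP F E _).1 (lexx _).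
  by apply: le_trans qb; exact: dqE Eb.
have uK := hyperspace_ultrametric (m := m) (l := l) uA.
apply/eqP; rewrite eq_le ge_max rFE /=; apply/andP; split.
  apply: (le_trans (uK _ _ P KF KE KP)).
  by rewrite ge_max !le_max lexx orbT andbT metric_sym PF.
by apply: (ultra_le uK KF) => //; apply: le_trans rFE.
Qed.

End HyperspaceUrysohn.

(** * Completeness of hyperspaces *)

Lemma not_card_le_fset (T : choiceType) (E : set T) k : ~ (E #<= `I_k)%card ->
  exists2 X : {fset T}, [set` X] `<=` E & (k < #|` X|)%N.
Proof.
move=> nE; have [/finite_fsetP[X EX]|iE] := pselect (finite_set E); last first.
  by have [X] := infinite_set_fset k.+1 iE; exists X.
exists X; first by rewrite EX.
rewrite ltnNge; apply/negP => h; apply: nE; rewrite EX.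
have /card_eq_fsetP XX := erefl #|` X|.
by rewrite (card_le_eql XX) card_le_II.
Qed.

Lemma fset_separated (R : realType) (M : metricType R) (X : {fset M}) :
  exists2 e : R, 0 < e &
    forall x y, x \in X -> y \in X -> x <> y -> e < mdist x y.
Proof.
pose P := [set z : M * M | (z.1 \in X /\ z.2 \in X) /\ z.1 <> z.2].
have finP : finite_set P.
  apply: (@sub_finite_set _ _ ([set` X] `*` [set` X])); first by move=> z [].
  by apply: finite_setX; exact: finite_fset.
have [P0|/set0P ne] := eqVneq P set0.
  exists 1 => // x y Xx Xy xy; have : P (x, y) by [].
  by rewrite P0.
have [[a b] [/= _ ab] min] := finite_set_argmin (fun z => mdist z.1 z.2) finP ne.
have ab0 : 0 < mdist a b by rewrite mdist_gt0; apply/eqP.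
exists (mdist a b / 2); first by rewrite divr_gt0.
move=> x y Xx Xy xy; have /= := min (x, y) (conj (conj Xx Xy) xy).
by apply: lt_le_trans; rewrite ltr_pdivrMr// ltr_pMr// ltr1n.
Qed.

Section HyperspaceComplete.
Context {R : realType} {M : metricType R}.
Variables (m : option nat) (l : \bar R) (A : set M).
Hypothesis uA : ultrametric A.
Local Notation K := (hyperspace_in m l A).

Local Notation "''e_' k" := (k.+1%:R^-1 : R) (at level 8, k at level 2).

(** The limit collects the points of [A] within [1 / (k + 1)] of every term [v k] of a fast
    subsequence. The bounds pass to it because distinct points of the limit are close to distinct
    points of a late [v k], at least as far apart. *)
Lemma hyperspace_complete : (0 <= l)%E -> complete_subspace A -> complete_subspace K.
Proof.
move=> l0 cA u Ku /cauchy_mdistP cu.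
have uK := hyperspace_ultrametric (m := m) (l := l) uA.
have e0 k : 0 < 'e_k by rewrite invr_gt0.
have e_le j k : (j <= k)%N -> 'e_k <= 'e_j.
  by move=> jk; rewrite lef_pV2 ?posrE ?ltr0n// ler_nat.
have /choice[N HN] k := cu _ (e0 k).
pose v k := u (N k); have Kv k : K (v k) by exact: Ku.
have vv j k : (j <= k)%N -> mdist (v j) (v k) <= 'e_j.
  move=> jk; apply: (@ultra_le _ _ _ uK (u (maxn (N j) (N k)))) => //.
    by rewrite ltW// HN// leq_maxl.
  by apply: le_trans (e_le _ _ jk); rewrite ltW// HN// leq_maxr.
have vA k y : hset (v k) y -> A y by move/(Kv k).2.
pose E := [set x | A x /\ forall k, exists2 y, hset (v k) y & mdist x y <= 'e_k].
(* The point [y] is followed through the later terms, each step being bounded by the current ['e_];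
   the limit of this path is the required point. *)
have Ev k y : hset (v k) y -> exists2 x, E x & mdist y x <= 'e_k.
  move=> vy.
  have /choice[st stP] (z : nat * M) : exists y', hset (v z.1) z.2 ->
      hset (v z.1.+1) y' /\ mdist z.2 y' <= 'e_z.1.
    have [vz|] := pselect (hset (v z.1) z.2); last by exists z.2.
    have [/(_ _ vz)[y' vy' h] _] := (hyper_mdist_leP _ _ _).1 (vv _ _ (leqnSn z.1)).
    by exists y'.
  pose fix w i := if i is i'.+1 then st ((k + i')%N, w i') else y.
  have vw i : hset (v (k + i)%N) (w i).
    elim: i => [|i IH]; first by rewrite addn0.
    by rewrite addnS; exact: (stP (_, _) IH).1.
  have ww i j : mdist (w i) (w (i + j)%N) <= 'e_(k + i)%N.
    elim: j => [|j IH]; first by rewrite addn0 mdistxx ltW.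
    apply: (ultra_le uA (vA _ _ (vw (i + j)%N))) => //; try exact: vA (vw _).
    rewrite addnS /=; apply: (le_trans (stP (_, _) (vw _)).2).
    by apply: e_le; rewrite leq_add2l leq_addr.
  have [|x Ax /cvg_mdistP wx] := cA w (fun i => vA _ _ (vw i)).
    apply/cauchy_mdistP => e /invSn_lt[n0 Hn0]; exists n0 => a b na nb.
    have small c : (n0 <= c)%N -> mdist (w n0) (w c) < e.
      move=> /subnKC <-; apply: (le_lt_trans (ww _ _)); apply: Hn0.
      exact: leq_addl.
    apply: (ultra_lt uA (vA _ _ (vw n0))); try exact: vA (vw _).
      by rewrite metric_sym small.
    exact: small.
  have xw i : mdist x (w i) <= 'e_(k + i)%N.
    have [n Hn] := wx _ (e0 (k + i)%N).
    apply: (ultra_le uA (vA _ _ (vw (i + n)%N))) => //; first exact: vA (vw _).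
      by rewrite ltW// Hn// leq_addl.
    by rewrite metric_sym.
  exists x; last by have := xw 0%N; rewrite addn0 metric_sym.
  split=> // j; have [kj|jk] := leqP k j.
    by exists (w (j - k)%N); [have := vw (j - k)%N|have := xw (j - k)%N];
      rewrite subnKC.
  (* The path starts at index [k]; for smaller [j], a point of [v j] close to [y] is used. *)
  have [_ /(_ _ vy)[z vz yz]] := (hyper_mdist_leP _ _ _).1 (vv _ _ (ltnW jk)).
  exists z => //; apply: (ultra_le uA (vA _ _ vy)) => //; first exact: vA vz.
  have := xw 0%N; rewrite addn0 => /le_trans; apply.
  exact/e_le/ltnW.
have E0 : E !=set0.
  by have [y vy] := hset_nonempty (v 0%N); have [x Ex _] := Ev _ _ vy; exists x.
have EA : E `<=` A by move=> x [].
have cE : compact E.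
  apply: (totally_bounded_compact cA EA).
  - move=> x Ax /closure_mdistP clx; split=> // k.
    have [y Ey xy] := clx _ (e0 k); have [z vz yz] := Ey.2 k.
    exists z => //; apply: (ultra_le uA Ey.1) => //; first exact: vA vz.
    exact: ltW.
  - move=> e /invSn_lt[k /(_ k (leqnn _)) ke].
    have [F [finF FE Fcov]] := compact_finite_net (@hset_compact _ _ (v k)) (e0 k).
    exists F => // x [Ax /(_ k)[y vy xy]]; have [z Fz yz] := Fcov _ vy.
    exists z => //; apply: le_lt_trans ke.
    apply: (ultra_le uA (vA _ _ vy)) => //; first by apply: vA; exact: FE.
    exact: ltW.
pose L := Hyperspace E0 cE.
have Lv k : mdist L (v k) <= 'e_k.
  by apply/hyper_mdist_leP; split=> [x [_ /(_ k)]|y /Ev].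
have KL : K L.
  split=> //; split.
  - case Em : m => [k0|//] /=; apply: contrapT => /not_card_le_fset[X XE Xk].
    have [e ee0 Xe] := fset_separated X.
    have [k /(_ k (leqnn _)) ke] := invSn_lt ee0.
    have /choice[h hP] x : exists y, x \in X -> hset (v k) y /\ mdist x y <= 'e_k.
      have [Xx|] := boolP (x \in X); last by exists x.
      by have [_ /(_ k)[y ? ?]] := XE _ Xx; exists y.
    have inj : {in [set` X] &, injective h}.
      move=> x y /set_mem /= Xx /set_mem /= Xy hxy; apply: contrapT => xy.
      have := Xe x y Xx Xy xy; rewrite ltNge => /negP; apply.
      have [vx dx] := hP x Xx; have [vy dy] := hP y Xy.
      apply: (ultra_le uA (vA _ _ vx)); try exact/EA/XE.
        by rewrite (le_trans dx)// ltW.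
      by rewrite hxy metric_sym (le_trans dy)// ltW.
    have : ([set` X] #<= `I_k0)%card.
      rewrite -(card_le_eql (inj_card_eq inj)).
      have [[+ _] _] := Kv k; rewrite Em /=; apply: card_le_trans.
      by apply: subset_card_le => _ [x Xx <-]; exact: (hP x Xx).1.
    have /card_eq_fsetP XX := erefl #|` X|.
    rewrite (card_le_eql XX) card_le_II.
    by rewrite leqNgt Xk.
  - apply: ge_ereal_sup => _ [x Ex [y Ey <-]].
    have [->|xy] := eqVneq x y; first by rewrite mdistxx.
    have : 0 < mdist x y by rewrite mdist_gt0.
    move=> /invSn_lt[k /(_ k (leqnn _)) ke].
    have [x' vx xx'] := Ex.2 k; have [y' vy yy'] := Ey.2 k.
    apply: (le_trans _ (Kv k).1.2); apply: le_trans (diam_ub vx vy).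
    rewrite lee_fin leNgt; apply/negP => xy'.
    suff : mdist x y < mdist x y by rewrite ltxx.
    have [? ?] := (vA _ _ vx, vA _ _ vy).
    apply: (@ultra_lt _ _ _ uA x') => //;
      [exact: Ex.1|exact: Ey.1|exact: le_lt_trans ke|].
    apply: (@ultra_lt _ _ _ uA y') => //; first exact: Ey.1.
    by rewrite metric_sym; exact: le_lt_trans ke.
exists L => //; apply/cvg_mdistP => e /invSn_lt[k /(_ k (leqnn _)) ke].
exists (N k) => n Nn; apply: (ultra_lt uK (Kv k)) => //.
  exact: le_lt_trans ke.
by apply: lt_trans ke; exact: HN.
Qed.

End HyperspaceComplete.

Theorem hyperspace_separable_urysohn (R : realType) (M : metricType R)
    (m : option nat) (l : \bar R) (S : set R) (A : set M) :
  (forall k, m = Some k -> (2 <= k)%N) -> (0 < l)%E -> range_set S ->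
  separable_urysohn S A -> separable_urysohn S (hyperspace_in m l A).
Proof.
move=> hm hl rS [sA cA [A0 injA] [uA SA]].
split; first exact: hyperspace_separable.
- by apply: hyperspace_complete => //; exact: ltW.
- apply: one_point_class_injective.
    have [a Aa] := A0; have [E _ KE] := hyperspace_set1 hm hl Aa.
    by exists E.
  apply: hyperspace_one_point_injective => //.
  exact: class_injective_one_point.
- split; first exact: hyperspace_ultrametric.
  by move=> E F; apply: hyperspace_valued => //; case: rS.
Qed.

(** * Tenuous sets *)

Section Tenuous.
Context {R : realType}.
Implicit Types S T U : set R.

(** For range sets this is equivalent to tenuousness, and it passes to subsets and finite unions
    with no case distinction. *)
Definition finite_above S := forall e : R, 0 < e -> finite_set [set r | S r /\ e <= r].

Lemma tenuous_finite_above S : tenuous S -> finite_above S.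
Proof.
move=> [finS|[a [_ _ a0 ->]]] e e0.
  by apply: sub_finite_set finS => r [].
have /cvgrPdist_lt /(_ e e0)[N _ HN] := a0.
apply: (@sub_finite_set _ _ (a @` `I_N)); last exact/finite_image/finite_II.
move=> r [[/= ->|[n _ <-]] er]; first by rewrite leNgt e0 in er.
exists n => //=; rewrite ltnNge; apply/negP => /HN /=.
rewrite sub0r normrN => h.
by have := le_lt_trans (ler_norm _) h; rewrite ltNge er.
Qed.

(** An infinite [S] is listed downwards: [nxt x] is the largest element below [x], which exists as
    [S] has positive elements below [x] and only finitely many above each of them. *)
Lemma finite_above_tenuous S : range_set S -> finite_above S -> tenuous S.
Proof.
move=> [S0 Sge0] fS; have [|iS] := pselect (finite_set S); [by left|right].
have small x : 0 < x -> exists s, [/\ S s, 0 < s & s < x].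
  move=> x0; apply: contrapT => C; apply: iS.
  apply: (@sub_finite_set _ _ ([set 0] `|` [set r | S r /\ x <= r])).
    move=> s Ss; have := Sge0 _ Ss; rewrite le_eqVlt => /orP[/eqP <-|s0].
      by left.
    by right; split=> //; rewrite leNgt; apply/negP => sx; apply: C; exists s.
  by rewrite finite_setU; split; [exact: finite_set1|exact: fS].
have /choice[nxt nxtP] x : exists y, 0 < x ->
    [/\ S y, 0 < y, y < x & forall s, S s -> s < x -> s <= y].
  have [x0|] := pselect (0 < x); last by exists 0.
  have [s0 [Ss0 s00 s0x]] := small x x0.
  have [||y [[Sy s0y] yx] ymax] := @finite_set_argmin R R
      ([set r | S r /\ s0 <= r] `&` [set r | r < x]) (@GRing.opp R).
  - by apply: finite_setIl; exact: fS.
  - by exists s0; split.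
  - exists y => _; split=> //; first exact: lt_le_trans s0y.
    move=> s Ss sx; have [ss0|s0s] := leP s s0; first exact: le_trans s0y.
    by have := ymax s; rewrite lerN2; apply; split=> //; split=> //; exact: ltW.
have [b b0 Sb] : exists2 b, 0 < b & forall s, S s -> s < b.
  have [E0|/set0P E0] := eqVneq [set r | S r /\ 1 <= r] set0.
    exists 1 => // s Ss; rewrite ltNge; apply/negP => h.
    by have : [set r | S r /\ 1 <= r] s by []; rewrite E0.
  have [c [Sc c1] cmax] := finite_set_argmin (@GRing.opp R) (fS _ ltr01) E0.
  exists (c + 1); first by lra.
  move=> s Ss; have [s1|s1] := ltP s 1; first by lra.
  by have := cmax s (conj Ss s1); lra.
(* [b] exceeds all of [S], so the listing starts after one application of [nxt], at the maximum of
   [S]. *)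
pose a n := iter n.+1 nxt b.
have aS n : S (a n) /\ 0 < a n.
  elim: n => [|n [_ IH]]; first by have [] := nxtP b b0.
  by have [] := nxtP (a n) IH.
have a_lt n : a n.+1 < a n by have [] := nxtP (a n) (aS n).2.
have a_dec : decreasing_seq a.
  have a_dec' : {homo a : m n / (m < n)%N >-> (n < m)%O}.
    by apply: homo_ltn => [y x z xy yz|]; [exact: lt_trans yz xy|exact: a_lt].
  move=> m n; apply/idP/idP => [|mn].
    by apply: contraTT; rewrite -ltnNge -ltNge => /a_dec'.
  by have := mn; rewrite leq_eqVlt => /orP[/eqP ->|/a_dec'/ltW].
have a_small e : 0 < e -> exists n, a n < e.
  move=> e0; apply: contrapT => C; apply: infinite_nat.
  have inj : {in [set: nat] &, injective a}.
    move=> x y _ _ xy; apply/eqP.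
    by rewrite eqn_leq -!a_dec xy lexx.
  rewrite -(eq_finite_set (inj_card_eq inj)).
  apply: sub_finite_set (fS e e0) => _ [n _ <-]; split; first exact: (aS n).1.
  by rewrite leNgt; apply/negP => h; apply: C; exists n.
exists a; split=> //.
- by move=> i; exact: (aS i).2.
- apply/cvgrPdist_lt => e /a_small[N aN]; exists N => // n /= Nn.
  rewrite sub0r normrN gtr0_norm ?(aS n).2//.
  by apply: le_lt_trans aN; rewrite a_dec.
- apply/seteqP; split=> [s Ss|s [->//|[n _ <-]]]; last exact: (aS n).1.
  have := Sge0 _ Ss; rewrite le_eqVlt => /orP[/eqP <-|s0]; [by left|right].
  (* At the first index with [a n < s], the preceding term is [s]; index [0] is excluded since [a 0]
     is the maximum. *)
  have [n an nmin] := ex_minnP (a_small s s0).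
  case: n an nmin => [|n] an nmin.
    have [_ _ _ /(_ s Ss (Sb s Ss))] := nxtP b b0.
    by rewrite leNgt -[nxt b]/(a 0%N) an.
  exists n => //; apply/eqP; rewrite eq_le; apply/andP; split.
    rewrite leNgt; apply/negP => san.
    have [_ _ _ /(_ s Ss san)] := nxtP (a n) (aS n).2.
    by rewrite leNgt -[nxt _]/(a n.+1) an.
  by rewrite leNgt; apply/negP => /nmin; rewrite ltnn.
Qed.

Lemma finite_aboveS S T : S `<=` T -> finite_above T -> finite_above S.
Proof.
by move=> ST fT e /fT; apply: sub_finite_set => r /= [/ST].
Qed.

Lemma finite_aboveU S T : finite_above S -> finite_above T -> finite_above (S `|` T).
Proof.
move=> fS fT e e0; apply: (@sub_finite_set _ _
    ([set r | S r /\ e <= r] `|` [set r | T r /\ e <= r])).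
  by move=> r /= [[Sr|Tr] er]; [left|right].
by rewrite finite_setU; split; [exact: fS|exact: fT].
Qed.

Lemma TENP S T : range_set S ->
  TEN S T <-> [/\ T 0, T `<=` S & finite_above T].
Proof.
move=> [_ Sge0]; split=> [[[T0 _] tT TS]|[T0 TS fT]].
  by split=> //; exact: tenuous_finite_above.
have rT : range_set T by split=> // r /TS /Sge0.
by split=> //; exact: finite_above_tenuous.
Qed.

Lemma TEN_U S T U : range_set S -> TEN S T -> TEN S U -> TEN S (T `|` U).
Proof.
move=> rS /(TENP _ rS)[T0 TS fT] /(TENP _ rS)[U0 US fU]; apply/TENP => //.
by split; [left|rewrite subUset; split|exact: finite_aboveU].
Qed.

Lemma TEN_sub S T U : range_set S -> TEN S T -> U 0 -> U `<=` T -> TEN S U.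
Proof.
move=> rS /(TENP _ rS)[_ TS fT] U0 UT; apply/TENP => //.
by split=> //; [exact: subset_trans TS|exact: finite_aboveS fT].
Qed.

Lemma TEN_pair S r : range_set S -> S r -> TEN S [set 0; r].
Proof.
move=> rS Sr; apply/(TENP _ rS); split; first by left.
  by move=> s [->|->] //; exact: rS.1.
move=> e e0; apply: (@sub_finite_set _ _ [set 0; r]); first by move=> s [].
by rewrite finite_setU; split; exact: finite_set1.
Qed.

End Tenuous.

Lemma finite_above_gap (R : realType) (S : set R) (r : R) :
  finite_above S -> 0 < r ->
  exists2 e : R, 0 < e & forall s, S s -> r < s -> r + e <= s.
Proof.
move=> fS r0; pose V := [set s | S s /\ r < s].
have finV : finite_set V.
  by apply: sub_finite_set (fS r r0) => s [? /ltW].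
have [V0|/set0P V0] := eqVneq V set0.
  by exists 1 => // s Ss rs; have : V s by []; rewrite V0.
have [t [St rt] tmin] := finite_set_argmin id finV V0.
exists (t - r); first by rewrite subr_gt0.
by move=> s Ss rs; rewrite addrC subrK; exact: tmin.
Qed.

(** * Petals *)

Section Petal.
Context {R : realType} {M : metricType R}.
Variables (Rg : set R) (A : set M) (Pi : set R -> set M).
Hypotheses (rRg : range_set Rg) (unc : ~ countable Rg).
Hypotheses (vA : valued_ultrametric Rg A) (petPi : is_petal Rg A Pi).
Implicit Types (S T U : set R) (x y z : M) (r : R).

Let uA : ultrametric A := vA.1.

(** The Urysohn property of petals is silent on the value set [{0}]; a spare value enlarges any [T]
    to a set where it applies. *)
Lemma uncountable_pos (r : R) : exists2 s, Rg s & 0 < s /\ s <> r.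
Proof.
apply: contrapT => C; apply: unc; apply: finite_set_countable.
apply: (@sub_finite_set _ _ [set 0; r]).
  move=> s Rs; have := rRg.2 _ Rs; rewrite le_eqVlt => /orP[/eqP <-|s0].
    by left.
  by right; apply: contrapT => sr; apply: C; exists s => //; split.
by rewrite finite_setU; split; exact: finite_set1.
Qed.

Lemma petal_urysohn T : TEN Rg T -> T <> [set 0] -> separable_urysohn T (Pi T).
Proof. by case: petPi => + _ _ _; apply. Qed.

Lemma petal_sub T : TEN Rg T -> Pi T `<=` A.
Proof. by case: petPi => _ <- _ _ tT x Tx; exists T. Qed.

Lemma petal_cover x : A x -> exists2 T, TEN Rg T & Pi T x.
Proof. by case: petPi => _ <- _ _ [T]; exists T. Qed.

Lemma petalI T U : TEN Rg T -> TEN Rg U -> Pi T `&` Pi U = Pi (T `&` U).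
Proof. by case: petPi => _ _ + _; apply. Qed.

Lemma petal_mono T U : TEN Rg T -> TEN Rg U -> T `<=` U -> Pi T `<=` Pi U.
Proof. by move=> tT tU /setIidl TU; rewrite -TU -petalI// => x []. Qed.

Lemma TEN_add T r : TEN Rg T -> Rg r -> TEN Rg (T `|` [set 0; r]).
Proof. by move=> tT Rr; apply: TEN_U => //; exact: TEN_pair. Qed.

Lemma add_neq0 T r : 0 < r -> T `|` [set 0; r] <> [set 0].
Proof.
move=> r0 e; have : (T `|` [set 0; r]) r by right; right.
by rewrite e /= => r00; rewrite r00 ltxx in r0.
Qed.

Lemma TEN_0 T : TEN Rg T -> T 0.
Proof. by move=> [[]]. Qed.

Lemma petal_subadd T r : TEN Rg T -> Rg r -> Pi T `<=` Pi (T `|` [set 0; r]).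
Proof.
by move=> tT Rr; apply: petal_mono => //; exact: TEN_add.
Qed.

(** [T] is enlarged by a value other than [mdist x y]. *)
Lemma petal_valued T x y : TEN Rg T -> Pi T x -> Pi T y -> T (mdist x y).
Proof.
move=> tT Tx Ty; have [s Rs [s0 sr]] := uncountable_pos (mdist x y).
have [_ _ _ [_ /(_ x y)]] := petal_urysohn (TEN_add tT Rs) (add_neq0 s0).
case=> //; try exact: petal_subadd.
by case=> [->|e]; [exact: TEN_0|rewrite e in sr].
Qed.

(** [T] is the intersection of its enlargements by two distinct values. Their petals are complete,
    hence closed in [M], and petals commute with intersections. *)
Lemma petal_closed T x : TEN Rg T ->
  (forall e : R, 0 < e -> exists2 y, Pi T y & mdist x y < e) -> Pi T x.
Proof.
move=> tT clx.
have H s : Rg s -> 0 < s -> Pi (T `|` [set 0; s]) x.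
  move=> Rs s0; have [_ cP _ _] := petal_urysohn (TEN_add tT Rs) (add_neq0 s0).
  apply: (complete_subspace_closed cP); apply/closure_mdistP => e /clx[y Ty xy].
  by exists y => //; exact: petal_subadd.
have [s Rs [s0 _]] := uncountable_pos 0; have [t Rt [t0 ts]] := uncountable_pos s.
suff -> : T = (T `|` [set 0; s]) `&` (T `|` [set 0; t]).
  by rewrite -petalI; [split; exact: H|exact: TEN_add|exact: TEN_add].
apply/seteqP; split=> [r Tr|r [[//|[->|->]] [//|[e|e]]]]; first by split; left.
- exact: TEN_0.
- exact: TEN_0.
- by rewrite e; exact: TEN_0.
- by rewrite e in ts.
Qed.

(** The distance to the petal is nonzero because petals are closed. It is attained because distances
    of near-minimizers lie in the union of [T] and [U], which has no element just above [r]. *)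
Lemma petal_gap T U x : TEN Rg T -> TEN Rg U -> Pi U x -> ~ Pi T x ->
  exists r, [/\ U r, ~ T r, 0 < r, forall y, Pi T y -> r <= mdist x y
    & exists2 y, Pi T y & mdist x y = r].
Proof.
move=> tT tU Ux nTx; have [_ _ _ /(_ T U x tT tU Ux)[r Hr dr]] := petPi.
have lb y : Pi T y -> r <= mdist x y.
  by move=> Ty; rewrite -lee_fin -dr; apply: ereal_inf_lbound; exists y.
have /dist_to_set_leP ub : (dist_to_set x (Pi T) <= r%:E)%E by rewrite dr.
case: Hr => [r0|[Ur nTr]].
  case: nTx; apply: petal_closed => // e e0; have [y Ty h] := ub e e0.
  by exists y => //; rewrite r0 add0r in h.
have r0 : 0 < r.
  rewrite lt_neqAle; apply/andP; split; last by case: tU => -[_ +] _ _; apply.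
  by apply/eqP => r0; apply: nTr; rewrite -r0; exact: TEN_0.
exists r; split=> //; have tTU := TEN_U rRg tT tU.
have [_ _ fTU] := (TENP _ rRg).1 tTU.
have [e e0 gap] := finite_above_gap fTU r0.
have [y Ty xy] := ub e e0; exists y => //; apply/eqP; rewrite eq_le lb// andbT.
rewrite leNgt; apply/negP => ry.
have /gap/(_ ry) : (T `|` U) (mdist x y).
  apply: petal_valued => //.
    by apply: petal_mono Ux => //; exact: subsetUr.
  by apply: petal_mono Ty => //; exact: subsetUl.
by rewrite leNgt xy.
Qed.

Lemma TEN_near S T r : TEN Rg S -> TEN Rg T -> 0 <= r ->
  TEN Rg (S `|` [set t | T t /\ t <= r]).
Proof.
move=> tS tT r0; apply: TEN_U => //; apply: (TEN_sub rRg tT).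
  by split=> //; exact: (TEN_0 tT).
by move=> t [].
Qed.

(** Otherwise [petal_gap] makes the distance from [y] to this petal a value of [T] above [r],
    although the petal contains [x]. *)
Lemma petal_near S T x y r : TEN Rg S -> TEN Rg T -> Pi S x -> Pi T y ->
  mdist x y <= r -> Pi (S `|` [set t | T t /\ t <= r]) y.
Proof.
move=> tS tT Sx Ty xy; apply: contrapT => nU.
have tU := TEN_near tS tT (le_trans (mdist_ge0 x y) xy).
have [s [Ts nUs _ sy _]] := petal_gap tU tT Ty nU.
apply: nUs; right; split=> //; apply: le_trans xy; rewrite metric_sym.
by apply: sy; apply: petal_mono Sx => //; exact: subsetUl.
Qed.

Lemma petal_finite F : finite_set F -> F `<=` A ->
  exists2 T, TEN Rg T & F `<=` Pi T.
Proof.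
move=> /finite_seqP[s ->]; elim: s => [|x s IH] sA.
  by exists [set 0; 0]; [apply: TEN_pair => //; exact: rRg.1|].
have [|T tT sT] := IH.
  by move=> y ys; apply: sA; rewrite /= inE ys orbT.
have [U tU Ux] : exists2 U, TEN Rg U & Pi U x.
  by apply: petal_cover; apply: sA; rewrite /= mem_head.
have tTU := TEN_U rRg tT tU.
exists (T `|` U) => // y /=; rewrite inE => /orP[/eqP ->|/sT].
  by apply: petal_mono Ux => //; exact: subsetUr.
by apply: petal_mono => //; exact: subsetUl.
Qed.

Lemma petaloid_one_point_injective : one_point_injective Rg A.
Proof.
apply: one_point_injectiveW => F p r finF FA Fp Rr r0.
have [T tT FT] := petal_finite finF FA.
have tTr := TEN_add tT Rr.
have [_ _ injT vT] := petal_urysohn tTr (@add_neq0 T r r0).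
have [rT _ _] := tTr.
have FTr : F `<=` Pi (T `|` [set 0; r]).
  by apply: subset_trans FT _; exact: petal_subadd.
have [z Tz zF] := class_injective_one_point rT vT injT finF FTr (FTr _ Fp)
  (or_intror (or_intror erefl)) r0.
by exists z => //; exact: petal_sub Tz.
Qed.

(** Finer and finer nets of [E] are placed in petals; [petal_near] limits the values added from one
    net to the next, and closedness passes from the nets to [E]. *)
Lemma petal_compact E : compact E -> E `<=` A ->
  exists2 T, TEN Rg T & E `<=` Pi T.
Proof.
move=> cE EA.
have /choice[N NP] (n : nat) : exists F, [/\ finite_set F, F `<=` E &
    forall x, E x -> exists2 y, F y & mdist x y < n.+1%:R^-1].
  by apply: compact_finite_net => //; rewrite invr_gt0.
have /choice[V VP] n : exists T, TEN Rg T /\ N n `<=` Pi T.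
  have [finN NE _] := NP n.
  by have [T] := petal_finite finN (subset_trans NE EA); exists T.
(* Passing from [S n] to [S n.+1] only adds values at most [1 / (n + 1)], so the
   union of the [S n] is tenuous. *)
pose fix S n := if n is n'.+1
  then S n' `|` [set t | V n t /\ t <= n'.+1%:R^-1] else V 0%N.
have tS n : TEN Rg (S n).
  elim: n => [|n IH]; first exact: (VP 0%N).1.
  by apply: TEN_near => //; exact: (VP n.+1).1.
have NS n : N n `<=` Pi (S n).
  elim: n => [|n IH]; first exact: (VP 0%N).2.
  move=> y Ny; have [_ NE _] := NP n.+1; have [_ _ /(_ y (NE _ Ny))] := NP n.
  move=> [x Nx xy]; apply: (petal_near (tS n) (VP n.+1).1 (IH _ Nx)).
    exact: (VP n.+1).2.
  by rewrite metric_sym ltW.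
have S_mono n k : (n <= k)%N -> S n `<=` S k.
  by move=> /subnKC <-; elim: (k - n)%N => [|i IH]; rewrite ?addn0// addnS => t /IH; left.
have S_small n k t : (n <= k)%N -> S k t -> S n t \/ t <= n.+1%:R^-1.
  move=> /subnKC <-; elim: (k - n)%N => [|i IH]; first by rewrite addn0; left.
  rewrite addnS => -[/IH//|[_ h]]; right; apply: le_trans h _.
  by rewrite lef_pV2 ?posrE ?ltr0n// ler_nat ltnS leq_addr.
have tT : TEN Rg (\bigcup_n S n).
  apply/(TENP _ rRg); split.
  - by exists 0%N => //; exact: (TEN_0 (tS 0%N)).
  - by move=> t [n _]; case: (tS n) => _ _; apply.
  - move=> e e0; have [n /(_ n (leqnn _)) ne] := invSn_lt e0.
    have [_ _ /(_ e e0)] := (TENP _ rRg).1 (tS n).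
    apply: sub_finite_set => t [[k _ Sk] et]; split=> //.
    have [kn|/ltnW nk] := leqP k n; first exact: S_mono Sk.
    have [//|h] := S_small _ _ _ nk Sk.
    by have := lt_le_trans ne et; rewrite ltNge h.
exists (\bigcup_n S n) => // x Ex; apply: petal_closed => // e.
move=> /invSn_lt[n /(_ n (leqnn _)) ne]; have [_ _ /(_ x Ex)[y Ny xy]] := NP n.
exists y; last exact: lt_trans ne.
by apply: petal_mono (NS _ _ Ny) => //; exact: bigcup_sup.
Qed.

End Petal.

(** The covering axiom is [petal_compact]. For the distance axiom, the distance from [E] is the
    largest distance from a point of [E] to [Pi T]. *)
Theorem hyperspace_petaloid (R : realType) (M : metricType R)
    (m : option nat) (l : \bar R) (Rg : set R) (A : set M) :
  (forall k, m = Some k -> (2 <= k)%N) -> (0 < l)%E -> range_set Rg ->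
  ~ countable Rg -> petaloid Rg A -> petaloid Rg (hyperspace_in m l A).
Proof.
move=> hm hl rRg unc [vA [Pi petPi]].
have [uA SA] := vA.
have Pi_sub T : TEN Rg T -> Pi T `<=` A by move=> tT; exact: petal_sub petPi _ tT.
have mono (B C : set M) : B `<=` C -> hyperspace_in m l B `<=` hyperspace_in m l C.
  by move=> BC E [? EB]; split=> //; exact: subset_trans BC.
split.
  split; first exact: hyperspace_ultrametric.
  by move=> E F; apply: hyperspace_valued => //; case: rRg.
exists (fun T => hyperspace_in m l (Pi T)); split.
- move=> T tT T0; apply: hyperspace_separable_urysohn => //; first by case: tT.
  exact: petal_urysohn petPi _ tT T0.
- apply/seteqP; split=> [E [T tT]|E [hE EA]]; first exact/mono/Pi_sub.
  have [T tT ET] := petal_compact rRg unc petPi (@hset_compact _ _ E) EA.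
  by exists T.
- move=> T U tT tU; rewrite -(petalI petPi tT tU).
  by apply/seteqP; split=> [E [[? ?] [_ ?]]|E [? h]]; split=> //;
    [move=> x ?; split; auto|split=> // x /h []..].
move=> T U E tT tU KE.
have KE' : hyperspace_in m l A E by apply: mono KE; exact: Pi_sub.
have [hE EU] := KE.
pose gap x r := [/\ U r, ~ T r, 0 < r, forall y, Pi T y -> r <= mdist x y
    & exists2 y, Pi T y & mdist x y = r].
have gapP x : hset E x -> Pi T x \/ exists r, gap x r.
  move=> Ex; have [|nTx] := pselect (Pi T x); [by left|right].
  exact: (petal_gap rRg unc petPi tT tU (EU _ Ex) nTx).
have [ET|/existsNP[x1 /not_implyP[Ex1 nTx1]]] := pselect (hset E `<=` Pi T).
  exists 0; first by left.
  apply/eqP; rewrite eq_le dist_to_set_ge0 andbT.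
  by apply/dist_to_set_leP => e e0; exists E; rewrite ?mdistxx ?add0r.
have [r1 gap1] : exists r, gap x1 r by case: (gapP _ Ex1).
(* Gaps lie in [U], so only finitely many are at least [r1], and a largest one exists. *)
pose V := [set r | (exists2 x, hset E x & gap x r) /\ r1 <= r].
have finV : finite_set V.
  have [_ _ fU] := (TENP _ rRg).1 tU; have [_ _ r10 _ _] := gap1.
  by apply: sub_finite_set (fU _ r10) => r [[x _ [Ur _ _ _ _]] ?].
have [|r [[x Ex gapr] r1r] rmax] := finite_set_argmin (@GRing.opp R) finV.
  by exists r1; split=> //; exists x1.
have [Ur nTr r0 xr _] := gapr.
exists r; first by right.
apply/eqP; rewrite eq_le; apply/andP; split; last first.
  apply: le_ereal_inf_tmp => _ [F [_ FT] <-]; rewrite lee_fin.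
  have [/(_ x Ex)[y Fy xy] _] := (hyper_mdist_leP E F _).1 (lexx _).
  by apply: le_trans xy; apply: xr; exact: FT.
(* The bound is reached by discretizing at scale [r] and moving each net point to a nearest point of
   [Pi T], at most [r] away by maximality. *)
have [N [finN NE _ _ H]] := hyperspace_discretize uA KE' r0.
have /choice[g gP] y : exists z, hset E y -> Pi T z /\ mdist y z <= r.
  have [Ey|] := pselect (hset E y); last by exists y.
  have [Ty|[s gs]] := gapP _ Ey; first by exists y; rewrite mdistxx ltW.
  have [_ _ _ _ [z Tz yz]] := gs; exists z => _; split=> //; rewrite yz.
  have [sr1|r1s] := ltP s r1; first by rewrite (le_trans (ltW sr1)).
  have := rmax s; rewrite lerN2; apply; split=> //; by exists y.
have [|F [FE KF EF]] := H g.
  by move=> y /NE /gP [Tg ?]; split=> //; exact: Pi_sub Tg.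
apply: (@le_trans _ _ (mdist E F)%:E); last by rewrite lee_fin.
apply: ereal_inf_lbound; exists F => //; split; first by case: KF.
by move=> z; rewrite FE => -[y /NE /gP [? _] <-].
Qed.

(** * Coding by zero children *)

(* [Z x r] reads: the open [r]-ball of [x] is the distinguished one among the
   open [r]-balls that make up the closed [r]-ball of [x]. *)
Record zero_children (R : realType) (Rg : set R) (M : metricType R) (A : set M)
    (Z : M -> R -> Prop) : Prop := ZeroChildren {
  zc_valued : valued_ultrametric Rg A ;
  zc_injective : one_point_injective Rg A ;
  zc_near : forall x y r, A x -> A y -> Rg r -> 0 < r ->
    mdist x y < r -> Z x r -> Z y r ;
  zc_unique : forall x y r, A x -> A y -> Rg r -> 0 < r ->
    Z x r -> Z y r -> mdist x y <= r -> mdist x y < r ;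
  zc_below : forall x s, A x -> 0 < s -> exists y,
    [/\ A y, mdist x y < s & forall r, Rg r -> 0 < r -> r < s -> Z y r] ;
  zc_origin : exists2 o, A o & forall r, Rg r -> 0 < r -> Z o r ;
  zc_support : forall x, A x ->
    finite_above [set r | [/\ Rg r, 0 < r & ~ Z x r]] ;
  zc_net : forall x r, A x -> Rg r -> 0 < r -> exists D,
    [/\ countable D, D `<=` A &
      forall z, A z -> mdist x z <= r -> exists2 y, D y & mdist z y < r] ;
  zc_complete : forall (T : set R) (u : nat -> M), T `<=` Rg -> finite_above T ->
    (forall n, A (u n)) ->
    (forall n r, Rg r -> 0 < r -> ~ T r -> Z (u n) r) ->
    cauchy (u @ \oo) -> exists2 y, A y & u @ \oo --> y }.

(** Balls are numbered through their points: by the second and third clauses, two points of a closed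
    [r]-ball have equal numbers exactly when they share an open [r]-ball. *)
Definition is_coding (R : realType) (Rg : set R) (M : metricType R) (A : set M)
    (Z : M -> R -> Prop) (c : M -> R -> nat) := forall x r, A x -> Rg r -> 0 < r ->
  [/\ c x r = 0%N <-> Z x r,
      forall y, A y -> mdist x y < r -> c x r = c y r,
      forall y, A y -> mdist x y <= r -> c x r = c y r -> mdist x y < r
    & forall n, exists y, [/\ A y, mdist x y <= r & c y r = n.+1]].

Section Coding.
Context {R : realType} {Rg : set R} {M : metricType R} {A : set M}.
Context {Z : M -> R -> Prop}.
Hypothesis zc : zero_children Rg A Z.

Let uA : ultrametric A := (zc_valued zc).1.

Definition open_ball_in x r := [set w | A w /\ mdist x w < r].

Definition nonzero_children x r := [set B | exists z,
  [/\ A z, mdist x z <= r, ~ Z z r & B = open_ball_in z r]].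

Lemma open_ball_in_eq x y r : A x -> A y -> mdist x y < r ->
  open_ball_in x r = open_ball_in y r.
Proof.
move=> Ax Ay xy; apply/seteqP; split=> z [Az h]; split=> //.
  by apply: (ultra_lt uA Ax) => //; rewrite metric_sym.
exact: (ultra_lt uA Ay).
Qed.

Lemma nonzero_children_eq x y r : A x -> A y -> mdist x y <= r ->
  nonzero_children x r = nonzero_children y r.
Proof.
move=> Ax Ay xy; apply/seteqP; split=> B [z [Az h nZ ->]]; exists z; split=> //.
  by apply: (ultra_le uA Ax) => //; rewrite metric_sym.
exact: (ultra_le uA Ay).
Qed.

Lemma nonzero_children_countable x r : A x -> Rg r -> 0 < r ->
  countable (nonzero_children x r).
Proof.
move=> Ax Rr r0; have [D [cD DA cov]] := zc_net zc Ax Rr r0.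
apply: sub_countable cD.
apply: card_le_trans (card_image_le (fun y => open_ball_in y r) D).
apply: subset_card_le => B [z [Az xz _ ->]].
have [y Dy zy] := cov z Az xz; exists y => //.
by apply/esym/open_ball_in_eq => //; exact: DA.
Qed.

(** If there were finitely many, a one-point extension would give a point at distance exactly [r]
    from a representative of each and from the zero child, hence a further nonzero child. *)
Lemma nonzero_children_infinite x r : A x -> Rg r -> 0 < r ->
  infinite_set (nonzero_children x r).
Proof.
move=> Ax Rr r0 finQ.
have /choice[rho rhoP] (B : set M) : exists z, nonzero_children x r B ->
    [/\ A z, mdist x z <= r, ~ Z z r & B = open_ball_in z r].
  by have [[z ?]|] := pselect (nonzero_children x r B); [exists z|exists x].
have /choice[z0 z0P] (_ : unit) : exists z0, [/\ A z0, mdist x z0 <= r &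
    forall w, A w -> mdist x w <= r -> Z w r -> Z z0 r].
  have [[z [Az xz Zz]]|C] :=
      pselect (exists z, [/\ A z, mdist x z <= r & Z z r]); first by exists z.
  exists x; rewrite mdistxx ltW//; split=> // w Aw xw Zw.
  by case: C; exists w.
have [Az0 xz0 zz0] := z0P tt.
pose F := [set x; z0 tt] `|` rho @` nonzero_children x r.
have FA y : F y -> A y /\ mdist x y <= r.
  move=> [[->|->]|[B QB <-]] //; first by rewrite mdistxx ltW.
  by have [] := rhoP B QB.
have finF : finite_set F.
  rewrite !finite_setU; split; last exact: finite_image.
  by split; exact: finite_set1.
have [w Aw wF] := zc_injective zc finF (fun y Fy => (FA y Fy).1) Ax Rr r0.
have wr y : F y -> mdist w y = r.
  by move=> Fy; rewrite wF// max_l// (FA y Fy).2.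
have xw : mdist x w <= r by rewrite metric_sym wr//; left; left.
have [Zw|nZw] := pselect (Z w r).
  have := zc_unique zc Aw Az0 Rr r0 Zw (zz0 w Aw xw Zw).
  by rewrite wr ?ltxx; [move=> /(_ (lexx _))|left; right].
have Qw : nonzero_children x r (open_ball_in w r) by exists w.
have [_ _ _ e] := rhoP _ Qw.
have : open_ball_in w r w by split=> //; rewrite mdistxx.
rewrite e => -[_]; rewrite metric_sym wr ?ltxx//.
by right; exists (open_ball_in w r).
Qed.

Lemma coding_exists : exists c : M -> R -> nat, is_coding Rg A Z c.
Proof.
(* [g] depends only on the family of balls, so all points of a closed [r]-ball share one
   numbering. *)
have /choice[g gP] (Q : set (set M)) : exists g : set M -> nat,
    countable Q -> infinite_set Q -> set_bij Q setT g.
  have [[cQ iQ]|nQ] := pselect (countable Q /\ infinite_set Q); last first.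
    by exists (fun=> 0%N) => cQ iQ; case: nQ.
  have /card_set_bijP[g ?] : (Q #= [set: nat])%card.
    by apply/card_eqPle; split=> //; exact/infiniteP.
  by exists g.
pose c x r := if pselect (Z x r) then 0%N
  else (g (nonzero_children x r) (open_ball_in x r)).+1.
exists c => x r Ax Rr r0.
have gxP := gP _ (nonzero_children_countable Ax Rr r0)
              (nonzero_children_infinite Ax Rr r0).
split.
- by rewrite /c; case: pselect.
- move=> y Ay xy; rewrite /c.
  case: pselect => [Zx|nZx]; case: pselect => [Zy|nZy] //.
  + by case: nZy; exact: (zc_near zc Ax Ay).
  + by case: nZx; apply: (zc_near zc Ay Ax) Zy => //; rewrite metric_sym.
  + by rewrite (nonzero_children_eq Ax Ay (ltW xy)) (open_ball_in_eq Ax Ay xy).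
- move=> y Ay xy; rewrite /c.
  case: pselect => [Zx|nZx]; case: pselect => [Zy|nZy] //.
  + by move=> _; exact: (zc_unique zc).
  + rewrite -(nonzero_children_eq Ax Ay xy) => -[e].
    have [_ inj _] := gxP.
    have Qx : nonzero_children x r (open_ball_in x r).
      by exists x; rewrite mdistxx ltW.
    have Qy : nonzero_children x r (open_ball_in y r) by exists y.
    have h := inj _ _ (mem_set Qx) (mem_set Qy) e.
    have : open_ball_in y r y by split=> //; rewrite mdistxx.
    by rewrite -h; case.
- move=> n; have [_ _ /(_ n I)[B QB gB]] := gxP.
  have [z [Az xz nZz BE]] := QB.
  exists z; split=> //; rewrite /c; case: pselect => [//|nZ /=].
  by rewrite -(nonzero_children_eq Ax Az xz) -BE gB.
Qed.

End Coding.

Section Codes.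
Context {R : realType} {Rg : set R} {M : metricType R} {A : set M}.
Context {Z : M -> R -> Prop} (c : M -> R -> nat).

Hypotheses (zc : zero_children Rg A Z) (cP : is_coding Rg A Z c).

Let uA : ultrametric A := (zc_valued zc).1.

(** Induction on the number of support radii from [e] on, the least one [t] being treated last. A
    point with the right code above [t] is moved by at most [t] to correct the number at [t], then
    by less than [t] to clear those below; larger radii are unaffected. *)
Lemma code_truncated (k : R -> nat) (e : R) :
  finite_above [set r | [/\ Rg r, 0 < r & k r <> 0%N]] -> 0 < e ->
  exists2 x, A x & forall r, Rg r -> 0 < r -> c x r = if e <= r then k r else 0%N.
Proof.
set T := [set r | _] => fT e0.
have [s sE] : exists s : seq R, [set r | T r /\ e <= r] `<=` [set` s].
  by have /finite_seqP[s ->] := fT e e0; exists s.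
elim: {s}(size s) {-2}s (leqnn (size s)) e e0 sE => [|n IH] s sn e e0 sE.
  have [x0 Ax0 x0Z] := zc_origin zc; exists x0 => // r Rr r0.
  have [h _ _ _] := cP Ax0 Rr r0; rewrite (h.2 (x0Z r Rr r0)); case: ifP => // er.
  apply/esym; apply: contrapT => kr; have /sE : T r /\ e <= r by [].
  by move: sn; rewrite leqn0 => /nilP ->.
have [T0|/set0P T0] := eqVneq [set r | T r /\ e <= r] set0.
  apply: (IH [::]) => //; by rewrite T0.
have [t [[Rt t0 kt] et] tmin] := finite_set_argmin id (fT e e0) T0.
(* No support radius lies strictly between [t] and [t + d], so truncating at [t + d] loses only
   [t]. *)
have [d d0 gap] := finite_above_gap fT t0.
have [||x Ax cx] := IH (rem t s) _ (t + d) (addr_gt0 t0 d0).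
- have ts : t \in s by apply: sE; split.
  by rewrite size_rem// -ltnS prednK//; case: (s) ts.
- move=> r [Tr tdr] /=; apply: rem_mem; last first.
    apply: sE; split=> //; apply: le_trans et (le_trans _ tdr).
    by rewrite lerDl ltW.
  by apply/eqP => rt; move: tdr; rewrite rt leNgt ltrDl d0.
have [_ _ _ /(_ (k t).-1) [z [Az xz cz]]] := cP Ax Rt t0.
have [y [Ay zy yZ]] := zc_below zc Az t0.
exists y => // r Rr r0; have [tr|rt|rt] := ltgtP t r.
- have xy : mdist x y < r.
    by apply: (ultra_lt uA Az) => //; [exact: le_lt_trans tr|exact: lt_trans tr].
  have [_ /(_ y Ay xy) <- _ _] := cP Ax Rr r0.
  rewrite cx// (le_trans et (ltW tr)); case: leP => // rtd.
  apply/esym; apply: contrapT => kr.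
  by have /gap /(_ tr) : T r by []; rewrite leNgt rtd.
- have [h _ _ _] := cP Ay Rr r0; rewrite (h.2 (yZ r Rr r0 rt)).
  case: ifP => // er; apply/esym; apply: contrapT => kr.
  by have := tmin r (conj (And3 Rr r0 kr) er); rewrite leNgt rt.
- rewrite -rt; have [_ /(_ y Ay zy) <- _ _] := cP Az Rt t0.
  by rewrite cz et prednK// lt0n; apply/eqP.
Qed.

(** Truncations at [1 / (n + 1)] are realised by points [u n]. If two late ones were at distance
    [r >= e], their equal numbers at [r] would force a distance below [r]; so [u] is Cauchy, and its
    limit has the code [k]. *)
Lemma code_surjective (k : R -> nat) :
  finite_above [set r | [/\ Rg r, 0 < r & k r <> 0%N]] ->
  exists2 x, A x & forall r, Rg r -> 0 < r -> c x r = k r.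
Proof.
set T := [set r | _] => fT.
have /choice[u uP] (n : nat) : exists x, A x /\ forall r, Rg r -> 0 < r ->
    c x r = if n.+1%:R^-1 <= r then k r else 0%N.
  by have [|x] := @code_truncated k n.+1%:R^-1 fT; [rewrite invr_gt0|exists x].
have Au n : A (u n) by exact: (uP n).1.
have TRg : T `<=` Rg by move=> r [].
have [||y Ay uy] := @zc_complete _ _ _ _ _ zc T u TRg fT Au.
- move=> n r Rr r0 nTr; have [h _ _ _] := cP (Au n) Rr r0; apply/h.1.
  rewrite (uP n).2//; case: ifP => // _.
  by apply: contrapT => kr; apply: nTr.
- apply/cauchy_mdistP => e e0; have [N HN] := invSn_lt e0.
  exists N => n m Nn Nm; rewrite ltNge; apply/negP => enm.
  set r := mdist (u n) (u m) in enm.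
  have r0 : 0 < r by exact: lt_le_trans enm.
  have Rr : Rg r by exact: (zc_valued zc).2.
  have [_ _ /(_ _ (Au m) (lexx _))] := cP (Au n) Rr r0.
  rewrite ltxx (uP n).2// (uP m).2// !(le_trans (ltW (HN _ _)) enm)//.
  by move=> /(_ erefl).
exists y => // r Rr r0; have [N HN] := invSn_lt r0.
have [N' HN'] := (cvg_mdistP _ _).1 uy r r0.
have [_ /(_ _ (Au (maxn N N')) (HN' _ (leq_maxr _ _))) -> _ _] := cP Ay Rr r0.
by rewrite (uP _).2// ltW// HN// leq_maxl.
Qed.

Lemma code_support x : A x ->
  finite_above [set r | [/\ Rg r, 0 < r & c x r <> 0%N]].
Proof.
move=> Ax; apply: finite_aboveS (zc_support zc Ax) => r [Rr r0 cr].
split=> // Zr; apply: cr; have [h _ _ _] := cP Ax Rr r0; exact/h.2.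
Qed.

End Codes.

(** At the radius [r = d x' y'], a smaller [d x y] would make the numbers agree on both sides, which
    forces [d x' y' < r]. *)
Lemma same_code_mdist_le (R : realType) (Rg : set R) (M N : metricType R)
    (A : set M) (B : set N) (Z : M -> R -> Prop) (Z' : N -> R -> Prop)
    (c : M -> R -> nat) (c' : N -> R -> nat) x y x' y' :
  (forall u v, B u -> B v -> Rg (mdist u v)) ->
  is_coding Rg A Z c -> is_coding Rg B Z' c' ->
  A x -> A y -> B x' -> B y' ->
  (forall r, Rg r -> 0 < r -> c x r = c' x' r) ->
  (forall r, Rg r -> 0 < r -> c y r = c' y' r) ->
  mdist x' y' <= mdist x y.
Proof.
move=> RB cP cP' Ax Ay Bx By cx cy; rewrite leNgt; apply/negP => lt_xy.
set r := mdist x' y' in lt_xy.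
have Rr : Rg r by exact: RB.
have r0 : 0 < r by apply: le_lt_trans lt_xy; exact: mdist_ge0.
have [_ /(_ y Ay lt_xy) cxy _ _] := cP x r Ax Rr r0.
have [_ _ /(_ y' By (lexx _)) + _] := cP' x' r Bx Rr r0.
by rewrite ltxx -cx// -cy// => /(_ cxy).
Qed.

Theorem zero_children_isometric (R : realType) (Rg : set R) (M N : metricType R)
    (A : set M) (B : set N) (Z : M -> R -> Prop) (Z' : N -> R -> Prop) :
  zero_children Rg A Z -> zero_children Rg B Z' -> isometric A B.
Proof.
move=> zA zB.
have [c cP] := coding_exists zA; have [c' cP'] := coding_exists zB.
have [y0 By0 _] := zc_origin zB.
have RA u v : A u -> A v -> Rg (mdist u v) by exact: (zc_valued zA).2.
have RB u v : B u -> B v -> Rg (mdist u v) by exact: (zc_valued zB).2.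
have /choice[f fP] (x : M) : exists y, A x ->
    B y /\ forall r, Rg r -> 0 < r -> c x r = c' y r.
  have [Ax|] := pselect (A x); last by exists y0.
  have [y By cy] := code_surjective zB cP' (code_support zA cP Ax).
  by exists y => _; split=> // r Rr r0; rewrite cy.
have f_iso x y : A x -> A y -> mdist (f x) (f y) = mdist x y.
  move=> Ax Ay; have [Bx cx] := fP x Ax; have [By cy] := fP y Ay.
  apply/eqP; rewrite eq_le; apply/andP; split.
    exact: (same_code_mdist_le RB cP cP').
  by apply: (same_code_mdist_le RA cP' cP) => // r Rr r0; rewrite ?cx ?cy.
exists f; split=> //; split.
- by move=> x Ax; exact: (fP x Ax).1.
- move=> x y /set_mem Ax /set_mem Ay fxy; apply: mdist_positivity.
  by rewrite -f_iso// fxy mdistxx.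
- move=> y By; have [x Ax cx] := code_surjective zA cP (code_support zB cP' By).
  exists x => //; have [Bfx cfx] := fP x Ax; apply: mdist_positivity.
  (* [f x] and [y] both carry the code of [x], so their distance is at most [d x x]. *)
  apply/eqP; rewrite eq_le mdist_ge0 andbT -(mdistxx x).
  apply: (same_code_mdist_le RB cP cP') => // r Rr r0; exact: cx.
Qed.

(** * Zero children from petals and from dense sequences *)

Theorem petaloid_zero_children (R : realType) (Rg : set R) (M : metricType R)
    (A : set M) : range_set Rg -> ~ countable Rg -> petaloid Rg A ->
  exists Z, zero_children Rg A Z.
Proof.
move=> rRg unc [vA [Pi petPi]]; have [uA RA] := vA.
have cover := petal_cover petPi; have sub := petal_sub petPi.
have mono := petal_mono petPi.
have near := petal_near rRg unc petPi; have gap := petal_gap rRg unc petPi.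
exists (fun x r => exists T, [/\ TEN Rg T, Pi T x & ~ T r]); split=> //.
- exact: petaloid_one_point_injective petPi.
- move=> x y r Ax Ay Rr r0 xy [T [tT Tx nTr]].
  have [U tU Uy] := cover y Ay.
  exists (T `|` [set t | U t /\ t <= mdist x y]); split.
  + by apply: TEN_near => //; exact: mdist_ge0.
  + exact: near Tx Uy (lexx _).
  + by move=> [//|[_]]; rewrite leNgt xy.
- move=> x y r Ax Ay Rr r0 [T [tT Tx nTr]] [U [tU Uy nUr]].
  rewrite le_eqVlt => /orP[/eqP xyr|//].
  have tTU := TEN_U rRg tT tU.
  have : (T `|` U) (mdist x y).
    apply: (petal_valued rRg unc petPi tTU).
      by apply: mono Tx => //; exact: subsetUl.
    by apply: mono Uy => //; exact: subsetUr.
  by rewrite xyr => -[].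
- move=> x s Ax s0; have [T tT Tx] := cover x Ax.
  (* After the values below [s] are dropped, [x] is in the petal or its distance to it is a dropped
     value. *)
  pose U := [set 0] `|` [set t | T t /\ s <= t].
  have UT : U `<=` T by move=> t [->|[]//]; exact: TEN_0 tT.
  have tU : TEN Rg U by apply: (TEN_sub rRg tT) => //; left.
  suff [y Uy xy] : exists2 y, Pi U y & mdist x y < s.
    exists y; split=> //; first exact: sub Uy.
    move=> r Rr r0 rs; exists U; split=> // -[r00|[_]].
      by rewrite r00 ltxx in r0.
    by rewrite leNgt rs.
  have [Ux|nUx] := pselect (Pi U x); first by exists x; rewrite ?mdistxx.
  have [r [Tr nUr _ _ [y Uy xy]]] := gap _ _ _ tU tT Tx nUx.
  exists y => //; rewrite xy ltNge; apply/negP => sr.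
  by apply: nUr; right.
(* The origin is taken in the petal of [{0}], written [[set 0; 0]]; it is nonempty, as [petal_gap]
   finds in it a point nearest to one of a larger petal. *)
- have t0 : TEN Rg [set 0; 0] by apply: TEN_pair => //; exact: rRg.1.
  have [s Rs [s0 _]] := uncountable_pos rRg unc 0.
  have ts := TEN_pair rRg Rs.
  have ne : [set 0; s] <> [set 0].
    move=> e; have : [set 0; s] s by right.
    by rewrite e /= => s00; rewrite s00 ltxx in s0.
  have [_ _ [[x sx] _] _] := petal_urysohn petPi ts ne.
  have [y y0] : Pi [set 0; 0] !=set0.
    have [|n0x] := pselect (Pi [set 0; 0] x); first by exists x.
    by have [r [_ _ _ _ [y ? _]]] := gap _ _ _ t0 ts sx n0x; exists y.
  exists y; first exact: sub y0.
  by move=> r Rr r0; exists [set 0; 0]; split=> // -[|] r00; rewrite r00 ltxx in r0.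
- move=> x Ax; have [T tT Tx] := cover x Ax.
  have [_ _ fT] := (TENP _ rRg).1 tT.
  apply: finite_aboveS fT => r [Rr r0 nZ]; apply: contrapT => nTr.
  by apply: nZ; exists T.
- move=> x r Ax Rr r0; have [T tT Tx] := cover x Ax.
  have tTr := TEN_add rRg tT Rr.
  have [[D [cD DT TD]] _ _ _] := petal_urysohn petPi tTr (@add_neq0 _ T r r0).
  exists D; split=> //; first exact: subset_trans DT (sub _ tTr).
  move=> z Az xz; have [U tU Uz] := cover z Az.
  suff [y Ty zy] : exists2 y, Pi (T `|` [set 0; r]) y & mdist z y < r.
    have [w Dw yw] := (closure_mdistP _ _).1 (TD _ Ty) r r0.
    by exists w => //; apply: (ultra_lt uA (sub _ tTr _ Ty)) => //; apply: sub (DT _ Dw).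
  have [Tz|nTz] := pselect (Pi (T `|` [set 0; r]) z).
    by exists z; rewrite ?mdistxx.
  (* [z] lies in a petal whose values outside [T] are at most [r], while its distance to the
     separable petal avoids [T] and [r]; that distance is thus below [r]. *)
  have tV := TEN_near rRg tT tU (ltW r0).
  have [s [Vs nTs _ _ [y Ty zy]]] := gap _ _ _ tTr tV (near _ _ _ _ _ tT tU Tx Uz xz) nTz.
  exists y => //; rewrite zy lt_neqAle; apply/andP; split.
    by apply/eqP => sr; apply: nTs; right; right.
  by case: Vs => [Ts|[_ //]]; case: nTs; left.
- move=> T u TR fT Au uZ cu.
  have [s Rs [s0 _]] := uncountable_pos rRg unc 0.
  have tT : TEN Rg (T `|` [set 0; s]).
    apply/(TENP _ rRg); split; first by right; left.
      by move=> t [/TR//|[->|->]] //; exact: rRg.1.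
    apply: finite_aboveU => //.
    by have [_ _ ?] := (TENP _ rRg).1 (TEN_pair rRg Rs).
  (* Outside the petal, [u n] would have a distance [r] to it not in [T]; some petal through [u n]
     then avoids [r], yet the distance axiom puts [r] among its values. *)
  have uT n : Pi (T `|` [set 0; s]) (u n).
    apply: contrapT => nT; have [U tU Uu] := cover _ (Au n).
    have [r [Ur nTr r0 lb [y Ty uy]]] := gap _ _ _ tT tU Uu nT.
    have Rr : Rg r by case: tU => _ _; apply.
    have [|V [tV Vu nVr]] := uZ n r Rr r0; first by move=> ?; apply: nTr; left.
    have [t [Vt _ _ lb' [z Tz uz]]] := gap _ _ _ tT tV Vu nT.
    suff rt : r = t by rewrite rt in nVr.
    by apply/eqP; rewrite eq_le -{1}uz -{2}uy lb//= lb'.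
  have [_ cT _ _] := petal_urysohn petPi tT (@add_neq0 _ T s s0).
  by have [y Ty uy] := cT u uT cu; exists y => //; exact: sub Ty.
Qed.

Theorem separable_zero_children (R : realType) (Rg : set R) (M : metricType R)
    (A : set M) : range_set Rg -> separable_urysohn Rg A ->
  exists Z, zero_children Rg A Z.
Proof.
move=> rRg [[D [cD DA AD]] cA injA vA]; have [uA RA] := vA.
have [[a Aa] _] := injA.
have [q Dq qD] : exists2 q : nat -> M, forall n, D (q n) & D `<=` range q.
  move/pfcard_geP : cD => [D0|[f]].
    have [y] := (closure_mdistP D a).1 (AD _ Aa) 1 ltr01.
    by rewrite D0.
  by exists f; [move=> n; exact: (@funS _ _ _ _ f)|exact: (@surj _ _ _ _ f)].
have Aq n : A (q n) by apply: DA.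
have dense x e : A x -> 0 < e -> exists n, mdist (q n) x < e.
  move=> Ax e0; have [y Dy xy] := (closure_mdistP D x).1 (AD _ Ax) e e0.
  by have [n _ qn] := qD _ Dy; exists n; rewrite qn metric_sym.
exists (fun x r => exists2 i, mdist (q i) x < r &
  forall j, mdist (q j) x <= r -> (i <= j)%N); split=> //.
- exact: class_injective_one_point.
- move=> x y r Ax Ay Rr r0 xy [i qx imin]; exists i.
    exact: (ultra_lt uA Ax).
  move=> j qy; apply: imin; apply: (ultra_le uA Ay) => //.
  by rewrite metric_sym ltW.
- move=> x y r Ax Ay Rr r0 [i qx imin] [j qy jmin] xy.
  have ij : i = j.
    apply/eqP; rewrite eqn_leq; apply/andP; split.
      apply: imin; apply: (ultra_le uA Ay) => //; first exact: ltW.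
      by rewrite metric_sym.
    by apply: jmin; apply: (ultra_le uA Ax) => //; exact: ltW.
  apply: (ultra_lt uA (Aq i)) => //; first by rewrite metric_sym.
  by rewrite ij.
(* The first dense point of the open [s]-ball of [x] is also the first in each smaller closed ball
   around itself. *)
- move=> x s Ax s0; have [i qx imin] := ex_minnP (dense x s Ax s0).
  exists (q i); split=> //; first by rewrite metric_sym.
  move=> r Rr r0 rs; exists i; first by rewrite mdistxx.
  move=> j qji; apply: imin; apply: (ultra_lt uA (Aq i)) => //.
  exact: le_lt_trans rs.
- exists (q 0%N) => // r Rr r0; exists 0%N => //; by rewrite mdistxx.
- move=> x Ax e e0; have [n0 qx0] := dense x e Ax e0.
  have /choice[j jP] (r : R) : exists i, 0 < r ->
      mdist (q i) x <= r /\ forall k, mdist (q k) x <= r -> (i <= k)%N.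
    have [r0|] := pselect (0 < r); last by exists 0%N.
    have ex : exists i, mdist (q i) x <= r.
      by have [i /ltW] := dense x r Ax r0; exists i.
    by have [i qi imin] := ex_minnP ex; exists i.
  set V := [set r | _ /\ _].
  (* A repeated first index at radii [r < r'] would put the first dense point of the closed
     [r']-ball in the open one, making it a zero child. Indices at radii from [e] on are at most
     [n0], so [V] is finite. *)
  have inj : {in V &, injective j}.
    have jlt r r' : V r -> V r' -> r < r' -> j r <> j r'.
      move=> [[_ r0 _] _] [[_ r0' nZ] _] rr' jj; apply: nZ.
      exists (j r'); last exact: (jP r' r0').2.
      by rewrite -jj; apply: le_lt_trans rr'; exact: (jP r r0).1.
    move=> r r' /set_mem Vr /set_mem Vr' jj.
    case: (ltgtP r r') => // h; first by case: (jlt _ _ Vr Vr' h).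
    by case: (jlt _ _ Vr' Vr h).
  rewrite -(eq_finite_set (inj_card_eq inj)).
  apply: (@sub_finite_set _ _ `I_n0.+1); last exact: finite_II.
  move=> _ [r [[_ r0 _] er] <-] /=; rewrite ltnS; apply: (jP r r0).2.
  by rewrite (le_trans (ltW qx0)).
- move=> x r Ax Rr r0; exists D; split=> // z Az _.
  by have [n qn] := dense z r Az r0; exists (q n); rewrite // metric_sym.
- by move=> T u TR fT Au _; exact: cA.
Qed.

Theorem theorem1p4 (R : realType) (m : option nat) (Rg : set R) (l : \bar R)
    (X : metricType R)
    (hm : forall k, m = Some k -> (2 <= k)%N)
    (hS : range_set Rg)
    (hl : (0 < l)%E)
    (hX : urysohn_universal Rg [set: X]) :
  urysohn_universal Rg (@hyperspace_ml R X m l) /\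
  isometric (@hyperspace_ml R X m l) [set: X].
Proof.
have [cX uX] := hX; rewrite -hyperspace_inT.
have [cR|uR] := pselect (countable Rg).
  have UK := hyperspace_separable_urysohn hm hl hS (cX cR).
  split; first by split.
  have [Z zK] := separable_zero_children hS UK.
  have [Z' zX] := separable_zero_children hS (cX cR).
  exact: zero_children_isometric zK zX.
have PK := hyperspace_petaloid hm hl hS uR (uX uR).
split; first by split.
have [Z zK] := petaloid_zero_children hS uR PK.
have [Z' zX] := petaloid_zero_children hS uR (uX uR).
exact: zero_children_isometric zK zX.
Qed.
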